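(* Let $\mathbb{QT}$ be the linear species of finite topological quandles over a field $\mathbf{k}$. For disjoint finite sets $X_1,X_2$, let $m\big((X_1,\mathcal{T}_1,\lhd_1)\otimes(X_2,\mathcal{T}_2,\lhd_2)\big)=(X_1\sqcup X_2,\mathcal{T}_1\mathcal{T}_2,\widetilde{\lhd})$, where $\mathcal{T}_1\mathcal{T}_2$ is the disjoint union topology and $a\,\widetilde{\lhd}\,b=a\lhd_1 b$ for $a,b\in X_1$, $a\,\widetilde{\lhd}\,b=a\lhd_2 b$ for $a,b\in X_2$, and $a\,\widetilde{\lhd}\,b=a$ whenever $a\in X_1,b\in X_2$ or $a\in X_2,b\in X_1$. For any finite set $X$, let $\Gamma:\mathbb{QT}_X\to\mathbb{QT}_X\otimes\mathbb{QT}_X$ be the linear map $$\Gamma(X,\mathcal{T},\lhd)=\sum_{\mathcal{T}'\preccurlyeq_{\circ}\mathcal{T},\ \mathcal{T}'\ Q\text{-compatible}}(X,\mathcal{T}',\lhd)\otimes(X,\mathcal{T}/\mathcal{T}',\lhd),$$ where $Q=(X,\lhd)$. Then $(\mathbb{QT},m,\Gamma)$ is a commutative twisted bialgebra of the second kind.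
   Context: A quandle is a set $Q$ with a binary operation $\lhd$ such that (i) $a\lhd a=a$; (ii) for all $a,b$ there is a unique $c$ with $a=c\lhd b$; (iii) $(a\lhd b)\lhd c=(a\lhd c)\lhd(b\lhd c)$. The empty set with its unique structure is counted as a topological quandle. Topologies on a finite set $X$ are identified with quasi-orders on $X$: $x\le_{\mathcal T}y$ iff every $\mathcal T$-open subset containing $x$ contains $y$. Write $x\sim_{\mathcal T}y$ if $x\le_{\mathcal T}y$ and $y\le_{\mathcal T}x$. $\mathcal{T}_{|Y}$ is the induced topology on $Y\subseteq X$. For a finite quandle $Q=(X,\lhd)$, a topology $\mathcal{T}$ on $X$ is $Q$-compatible if $(X,\mathcal{T},\lhd)$ is a topological quandle: $\lhd:X\times X\to X$ is continuous and each $R_b:a\mapsto a\lhd b$ is a homeomorphism. Equivalently, $x\le_{\mathcal T}x'$ and $y\le_{\mathcal T}y'$ imply $x\lhd y\le_{\mathcal T}x'\lhd y'$. $\mathcal{T}'\prec\mathcal{T}$ means $x\le_{\mathcal{T}'}y\Rightarrow x\le_{\mathcal{T}}y$ (equality allowed). For $\mathcal{T}'\prec\mathcal{T}$, the quotient $\mathcal{T}/\mathcal{T}'$ is the topology on $X$ whose quasi-order is the transitive closure of: $x\,\mathcal{R}\,y$ iff $x\le_{\mathcal{T}}y$ or $y\le_{\mathcal{T}'}x$. The relation $\mathcal{T}'\preccurlyeq_{\circ}\mathcal{T}$ (written in the paper as a circled $\prec$) means: $\mathcal{T}'\prec\mathcal{T}$; $\mathcal{T}'_{|Y}=\mathcal{T}_{|Y}$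 for every subset $Y\subseteq X$ connected for $\mathcal{T}'$; and for all $x,y\in X$, $x\sim_{\mathcal{T}/\mathcal{T}'}y\iff x\sim_{\mathcal{T}'/\mathcal{T}'}y$. If $\mathcal{T}'\preccurlyeq_{\circ}\mathcal{T}$ and both are $Q$-compatible then $\mathcal{T}/\mathcal{T}'$ is $Q$-compatible, so $\Gamma$ is well defined. A linear species $\mathbb{E}$ is a contravariant functor from finite sets with bijections to $\mathbf{k}$-vector spaces. The Cauchy tensor product is $(\mathbb{E}\otimes\mathbb{F})_A=\bigoplus_{I\subseteq A}\mathbb{E}_I\otimes\mathbb{F}_{A\setminus I}$ and the Hadamard tensor product is $(\mathbb{E}\odot\mathbb{F})_A=\mathbb{E}_A\otimes\mathbb{F}_A$, with the obvious actions of bijections. $\mathbb{QT}_X$ is the vector space freely generated by the topological quandle structures $(X,\mathcal{T},\lhd)$ on $X$; bijections act by relabeling. A twisted bialgebra of the second kind is a species $\mathbb{P}$ with a species morphism $m:\mathbb{P}\otimes\mathbb{P}\to\mathbb{P}$ (associative and unital for the Cauchy tensor product) and a species morphism $\Gamma:\mathbb{P}\to\mathbb{P}\odot\mathbb{P}$ that makes each $\mathbb{P}_X$ a coassociative counital coalgebra, such that coproduct and counit are compatible with product and unit; in particular $\Gamma(m(x\otimes y))=(m\otimes m)\circ\tau_{23}\,(\Gamma(x)\otimes\Gamma(y))$ for $x\in\mathbb{P}_{X_1}$, $y\in\mathbb{P}_{X_2}$, where $\tau_{23}$ exchanges the second and third tensor factors. It is commutative if $m(x\otimes y)=m(y\otimes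 x)$ for all such $x,y$. *)

(* Defs.v *)
From HB Require Import structures.
From mathcomp Require Import all_boot all_order all_algebra all_fingroup.
From mathcomp Require Import finmap generic_quotient boolp.
From mathcomp.multinomials Require Import monalg.

Set Implicit Arguments.
Unset Strict Implicit.
Unset Printing Implicit Defensive.

Import GRing.Theory.

Local Open Scope ring_scope.
Local Open Scope quotient_scope.

(* [tensor V W] is the quotient of the free vector space on the set [V * W]
   by the subspace [tensor_rel] spanned by the bilinearity relations. *)

Section TensorRel.
Variables (k : fieldType) (V W : lmodType k).
Notation free := {malg k[(V * W)%type]}.

Inductive tensor_rel : free -> Prop :=
| Trel0 : tensor_rel 0
| TrelD x y : tensor_rel x -> tensor_rel y -> tensor_rel (x + y)
| TrelZ a x : tensor_rel x -> tensor_rel (a *: x)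
| Trel_Dl v v' w : tensor_rel (<< (v + v', w) >> - << (v, w) >> - << (v', w) >>)
| Trel_Dr v w w' : tensor_rel (<< (v, w + w') >> - << (v, w) >> - << (v, w') >>)
| Trel_Zl a v w : tensor_rel (<< (a *: v, w) >> - a *: << (v, w) >>)
| Trel_Zr a v w : tensor_rel (<< (v, a *: w) >> - a *: << (v, w) >>).

Lemma tensor_relN x : tensor_rel x -> tensor_rel (- x).
Proof. by rewrite -scaleN1r; apply: TrelZ. Qed.

Definition tensor_eqv (x y : free) : bool := `[< tensor_rel (x - y) >].

Lemma tensor_eqv_equiv : equiv_class_of tensor_eqv.
Proof.
split=> [x|x y|y x z].
- by apply/asboolP; rewrite subrr; exact: Trel0.
- by apply/asboolP/asboolP => /tensor_relN; rewrite opprB.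
- move=> /asboolP xy /asboolP yz; apply/asboolP.
  by rewrite -(subrK y x) -addrA; exact: TrelD.
Qed.

Canonical tensor_eqv_equivRel := EquivRelPack tensor_eqv_equiv.

Definition tensor := {eq_quot tensor_eqv}.
HB.instance Definition _ : EqQuotient free tensor_eqv tensor := EqQuotient.on tensor.
HB.instance Definition _ := Choice.on tensor.

Lemma tensor_eqP (x y : free) :
  reflect (tensor_rel (x - y)) (x == y %[mod tensor]).
Proof. by rewrite piE; exact: asboolP. Qed.

Definition tensor_zero : tensor := lift_cst tensor 0.
Definition tensor_add := lift_op2 tensor +%R.
Definition tensor_opp := lift_op1 tensor -%R.
Definition tensor_scale (a : k) := lift_op1 tensor ( *:%R a).

Canonical pi_tensor_zero_morph := PiConst tensor_zero.

Lemma pi_tensor_opp : {morph \pi : x / - x >-> tensor_opp x}.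
Proof.
move=> x; unlock tensor_opp; apply/eqP/tensor_eqP.
by rewrite -opprD; apply: tensor_relN; apply/tensor_eqP; rewrite reprK.
Qed.
Canonical pi_tensor_opp_morph := PiMorph1 pi_tensor_opp.

Lemma pi_tensor_add : {morph \pi : x y / x + y >-> tensor_add x y}.
Proof.
move=> x y; unlock tensor_add; apply/eqP/tensor_eqP.
rewrite opprD addrACA.
by apply: TrelD; apply/tensor_eqP; rewrite reprK.
Qed.
Canonical pi_tensor_add_morph := PiMorph2 pi_tensor_add.

Lemma pi_tensor_scale a : {morph \pi : x / a *: x >-> tensor_scale a x}.
Proof.
move=> x; unlock tensor_scale; apply/eqP/tensor_eqP.
by rewrite -scalerBr; apply: TrelZ; apply/tensor_eqP; rewrite reprK.
Qed.
Canonical pi_tensor_scale_morph a := PiMorph1 (pi_tensor_scale a).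

Lemma tensor_addA : associative tensor_add.
Proof. by elim/quotW=> x; elim/quotW=> y; elim/quotW=> z; rewrite !piE addrA. Qed.
Lemma tensor_addC : commutative tensor_add.
Proof. by elim/quotW=> x; elim/quotW=> y; rewrite !piE addrC. Qed.
Lemma tensor_add0 : left_id tensor_zero tensor_add.
Proof. by elim/quotW=> x; rewrite !piE add0r. Qed.
Lemma tensor_addN : left_inverse tensor_zero tensor_opp tensor_add.
Proof. by elim/quotW=> x; rewrite !piE addNr. Qed.
HB.instance Definition _ :=
  GRing.isZmodule.Build tensor tensor_addA tensor_addC tensor_add0 tensor_addN.

Lemma tensor_scaleA a b x :
  tensor_scale a (tensor_scale b x) = tensor_scale (a * b) x.
Proof. by elim/quotW: x => x; rewrite !piE scalerA. Qed.
Lemma tensor_scale1 : left_id 1 tensor_scale.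
Proof. by elim/quotW=> x; rewrite !piE scale1r. Qed.
Lemma tensor_scaleDr : right_distributive tensor_scale +%R.
Proof.
by move=> a; elim/quotW=> x; elim/quotW=> y;
   rewrite /GRing.add /= !piE scalerDr.
Qed.
Lemma tensor_scaleDl x : {morph tensor_scale^~ x : a b / a + b}.
Proof.
move=> a b; elim/quotW: x => x.
by rewrite [in RHS]/GRing.add /= !piE scalerDl.
Qed.
HB.instance Definition _ := GRing.Zmodule_isLmodule.Build k tensor
  tensor_scaleA tensor_scale1 tensor_scaleDr tensor_scaleDl.

Definition tensor_pi (x : free) : tensor := \pi x.

Lemma tensor_pi_is_linear : linear tensor_pi.
Proof.
move=> a x y; rewrite /tensor_pi.
by rewrite [in RHS]/GRing.add [in RHS]/GRing.scale /= !piE.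
Qed.
HB.instance Definition _ :=
  GRing.isLinear.Build k free tensor *:%R tensor_pi tensor_pi_is_linear.

Lemma tensor_piW (P : tensor -> Prop) :
  (forall x, P (tensor_pi x)) -> forall t, P t.
Proof. by move=> PP; elim/quotW. Qed.

Lemma tensor_pi_eq x y : tensor_rel (x - y) -> tensor_pi x = tensor_pi y.
Proof. by move=> xy; apply/eqP/tensor_eqP. Qed.

Definition tens (v : V) (w : W) : tensor := tensor_pi << (v, w) >>.
End TensorRel.

Notation "V ⊗ W" := (tensor V W) (at level 40, left associativity) : type_scope.
Notation "v ⊗ w" := (tens v w) (at level 40, left associativity) : ring_scope.

Section Tens.
Variables (k : fieldType) (V W : lmodType k).

Fact subr_telescope (M : zmodType) (q p r s : M) :
  p - (s + r) = (p - q - r) + (q - s).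
Proof. by rewrite [RHS]addrA [X in _ = X - _]addrAC subrK opprD addrA addrAC. Qed.

Lemma tens_is_bilinear : bilinear_for *:%R *:%R (@tens k V W).
Proof.
split=> [w|v] a x y; rewrite /tens -linearP; apply: tensor_pi_eq.
- rewrite (subr_telescope << (a *: x, w) >>).
  by apply: TrelD; [exact: Trel_Dl | exact: Trel_Zl].
- rewrite (subr_telescope << (v, a *: x) >>).
  by apply: TrelD; [exact: Trel_Dr | exact: Trel_Zr].
Qed.
HB.instance Definition _ := bilinear_isBilinear.Build k V W (V ⊗ W)%type
  *:%R *:%R (@tens k V W) tens_is_bilinear.

Lemma tensDl v v' w : (v + v') ⊗ w = v ⊗ w + v' ⊗ w :> (V ⊗ W)%type.
Proof. exact: linearDl. Qed.
Lemma tensDr v w w' : v ⊗ (w + w') = v ⊗ w + v ⊗ w' :> (V ⊗ W)%type.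
Proof. exact: linearDr. Qed.
Lemma tensZl a v w : (a *: v) ⊗ w = a *: (v ⊗ w) :> (V ⊗ W)%type.
Proof. exact: linearZl_LR. Qed.
Lemma tensZr a v w : v ⊗ (a *: w) = a *: (v ⊗ w) :> (V ⊗ W)%type.
Proof. exact: linearZr_LR. Qed.

Lemma tensor_ind (P : (V ⊗ W)%type -> Prop) :
  P 0 -> (forall s t, P s -> P t -> P (s + t)) -> (forall v w, P (v ⊗ w)) ->
  forall t, P t.
Proof.
move=> P0 PD PT; elim/tensor_piW=> g.
rewrite (monalgE g) linear_sum.
elim: (enum_fset (msupp g)) => [|[v w] s IHs]; first by rewrite big_nil.
rewrite big_cons; apply: PD => //=.
have -> : << g@_(v, w) *g (v, w) >> =
   g@_(v, w) *: (<< (v, w) >> : {malg k[(V * W)%type]}).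
  by apply/malgP => i; rewrite mcoeffZ !mcoeffU mulrnAr mulr1.
by rewrite linearZ /= -/(tens v w) -tensZl; exact: PT.
Qed.

Lemma tensor_lin_eq (U : lmodType k) (f g : {linear (V ⊗ W)%type -> U}) :
  (forall v w, f (v ⊗ w) = g (v ⊗ w)) -> f =1 g.
Proof.
move=> fg; elim/tensor_ind => [|s t es et|//]; first by rewrite !linear0.
by rewrite !linearD es et.
Qed.

Section Lift.
Variables (U : lmodType k) (b : {bilinear V -> W -> U}).

Definition free_eval (g : {malg k[(V * W)%type]}) : U :=
  \sum_(p <- msupp g) g@_p *: b p.1 p.2.

Lemma free_evalEw (g : {malg k[(V * W)%type]}) (d : {fset V * W}) :
  fsubset (msupp g) d -> free_eval g = \sum_(p <- d) g@_p *: b p.1 p.2.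
Proof.
move=> le; rewrite /free_eval (big_fset_incl _ le) //= => p _ /mcoeff_outdom ->.
by rewrite scale0r.
Qed.

Lemma free_eval_is_linear : linear free_eval.
Proof.
move=> a x y.
pose d := fsetU (msupp (a *: x + y)) (fsetU (msupp x) (msupp y)).
have le1 : fsubset (msupp (a *: x + y)) d by exact: fsubsetUl.
have le2 : fsubset (msupp x) d.
  exact: fsubset_trans (fsubsetUl _ _) (fsubsetUr _ _).
have le3 : fsubset (msupp y) d.
  exact: fsubset_trans (fsubsetUr _ _) (fsubsetUr _ _).
rewrite (free_evalEw le1) (free_evalEw le2) (free_evalEw le3).
rewrite scaler_sumr -big_split; apply: eq_bigr => p _.
by rewrite mcoeffD mcoeffZ scalerDl scalerA.
Qed.
HB.instance Definition _ :=
  GRing.isLinear.Build k {malg k[(V * W)%type]} U *:%R free_eval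
    free_eval_is_linear.

Lemma free_evalU p : free_eval << p >> = b p.1 p.2.
Proof.
by rewrite /free_eval msuppU oner_eq0 big_seq_fset1 mcoeffU eqxx mulr1n scale1r.
Qed.

Lemma free_eval_rel g : tensor_rel g -> free_eval g = 0.
Proof.
elim=> {g} [|x y _ ex _ ey|a x _ ex|v v' w|v w w'|a v w|a v w].
- exact: linear0.
- by rewrite linearD /= ex ey addr0.
- by rewrite linearZ /= ex scaler0.
- by rewrite !linearB /= !free_evalU /= linearDl addrAC addrK subrr.
- by rewrite !linearB /= !free_evalU /= linearDr addrAC addrK subrr.
- by rewrite linearB linearZ /= !free_evalU /= linearZl_LR subrr.
- by rewrite linearB linearZ /= !free_evalU /= linearZr_LR subrr.
Qed.

(* universal property: the linear map [v ⊗ w |-> b v w] *)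
Definition tlift (t : (V ⊗ W)%type) : U := free_eval (repr t).

Lemma tlift_pi g : tlift (tensor_pi g) = free_eval g.
Proof.
apply/eqP; rewrite /tlift -subr_eq0 -linearB; apply/eqP/free_eval_rel.
by apply/tensor_eqP; rewrite reprK.
Qed.

Lemma tlift_is_linear : linear tlift.
Proof.
move=> a; elim/tensor_piW=> x; elim/tensor_piW=> y.
by rewrite -linearP !tlift_pi linearP.
Qed.
HB.instance Definition _ :=
  GRing.isLinear.Build k (V ⊗ W)%type U *:%R tlift tlift_is_linear.

Lemma tliftE v w : tlift (v ⊗ w) = b v w.
Proof. by rewrite tlift_pi free_evalU. Qed.

End Lift.

Lemma tlift_comb (U : lmodType k) (b b1 b2 : {bilinear V -> W -> U}) a t :
  (forall v w, b v w = a *: b1 v w + b2 v w) ->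
  tlift b t = a *: tlift b1 t + tlift b2 t.
Proof.
move=> e; elim/tensor_piW: t => g; rewrite !tlift_pi /free_eval.
rewrite scaler_sumr -big_split; apply: eq_bigr => p _.
by rewrite e scalerDr !scalerA mulrC.
Qed.
End Tens.

Section TensorMaps.
Variable k : fieldType.

Section Map.
Variables (V V' W W' : lmodType k).
Variables (f : {linear V -> V'}) (g : {linear W -> W'}).

Definition tmap_pure (v : V) (w : W) : (V' ⊗ W')%type := f v ⊗ g w.
Lemma tmap_pure_bilinear : bilinear_for *:%R *:%R tmap_pure.
Proof.
by split=> [w|v] a x y; rewrite /tmap_pure linearP
  ?tensDl ?tensDr ?tensZl ?tensZr.
Qed.
HB.instance Definition _ := bilinear_isBilinear.Build k V W (V' ⊗ W')%type
  *:%R *:%R tmap_pure tmap_pure_bilinear.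

Definition tmap : {linear (V ⊗ W)%type -> (V' ⊗ W')%type} := tlift tmap_pure.
Lemma tmapE v w : tmap (v ⊗ w) = f v ⊗ g w.
Proof. exact: tliftE. Qed.
End Map.

Lemma tmap_id (V W : lmodType k) (f : {linear V -> V}) (g : {linear W -> W}) t :
  f =1 id -> g =1 id -> tmap f g t = t.
Proof.
move=> fE gE; apply: (tensor_lin_eq (f := tmap f g) (g := idfun)) => v w.
by rewrite tmapE fE gE.
Qed.

Lemma tmap_comp (V V' V'' W W' W'' : lmodType k)
    (f : {linear V' -> V''}) (f' : {linear V -> V'}) (f'' : {linear V -> V''})
    (g : {linear W' -> W''}) (g' : {linear W -> W'}) (g'' : {linear W -> W''}) t :
  f'' =1 f \o f' -> g'' =1 g \o g' -> tmap f'' g'' t = tmap f g (tmap f' g' t).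
Proof.
move=> fE gE.
apply: (tensor_lin_eq (f := tmap f'' g'') (g := tmap f g \o tmap f' g')) => v w.
by rewrite /= !tmapE fE gE.
Qed.

Section Assoc.
Variables (U V W : lmodType k).

Definition tassoc_pure3 (w : W) (u : U) (v : V) : (U ⊗ (V ⊗ W))%type :=
  u ⊗ (v ⊗ w).
Lemma tassoc_pure3_bilinear w : bilinear_for *:%R *:%R (tassoc_pure3 w).
Proof.
by split=> [v|u] a x y; rewrite /tassoc_pure3
  ?(tensDl, tensDr, tensZl, tensZr).
Qed.
HB.instance Definition _ w := bilinear_isBilinear.Build k U V
  (U ⊗ (V ⊗ W))%type *:%R *:%R (tassoc_pure3 w) (tassoc_pure3_bilinear w).

Definition tassoc_pure (t : (U ⊗ V)%type) (w : W) : (U ⊗ (V ⊗ W))%type :=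
  tlift (tassoc_pure3 w) t.
Lemma tassoc_pure_bilinear : bilinear_for *:%R *:%R tassoc_pure.
Proof.
split=> [w|t] a x y; rewrite /tassoc_pure; first by rewrite linearP.
apply: tlift_comb => u v; rewrite /= /tassoc_pure3.
by rewrite tensDr tensZr tensDr tensZr.
Qed.
HB.instance Definition _ := bilinear_isBilinear.Build k (U ⊗ V)%type W
  (U ⊗ (V ⊗ W))%type *:%R *:%R tassoc_pure tassoc_pure_bilinear.

Definition tassoc : {linear ((U ⊗ V) ⊗ W)%type -> (U ⊗ (V ⊗ W))%type} :=
  tlift tassoc_pure.
Lemma tassocE u v w : tassoc ((u ⊗ v) ⊗ w) = u ⊗ (v ⊗ w).
Proof. by rewrite [LHS]tliftE [LHS]tliftE. Qed.
End Assoc.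

Section Exchange.
Variables (A B C D : lmodType k).
Notation target := ((A ⊗ C) ⊗ (B ⊗ D))%type.

Definition tau23_pure4 (c : C) (d : D) (a : A) (b : B) : target :=
  (a ⊗ c) ⊗ (b ⊗ d).
Lemma tau23_pure4_bilinear c d : bilinear_for *:%R *:%R (tau23_pure4 c d).
Proof.
by split=> [?|?] z x y; rewrite /tau23_pure4 ?(tensDl, tensDr, tensZl, tensZr).
Qed.
HB.instance Definition _ c d := bilinear_isBilinear.Build k A B target
  *:%R *:%R (tau23_pure4 c d) (tau23_pure4_bilinear c d).

Definition tau23_pure3 (s : (A ⊗ B)%type) (c : C) (d : D) : target :=
  tlift (tau23_pure4 c d) s.
Lemma tau23_pure3_bilinear s : bilinear_for *:%R *:%R (tau23_pure3 s).
Proof.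
split=> [d|c] z x y; rewrite /tau23_pure3; apply: tlift_comb => a b /=.
- by rewrite /tau23_pure4 tensDr tensZr tensDl tensZl.
- by rewrite /tau23_pure4 tensDr tensZr tensDr tensZr.
Qed.
HB.instance Definition _ s := bilinear_isBilinear.Build k C D target
  *:%R *:%R (tau23_pure3 s) (tau23_pure3_bilinear s).

Definition tau23_pure (s : (A ⊗ B)%type) (t : (C ⊗ D)%type) : target :=
  tlift (tau23_pure3 s) t.
Lemma tau23_pure_bilinear : bilinear_for *:%R *:%R tau23_pure.
Proof.
split=> [t|s] z x y; rewrite /tau23_pure; last by rewrite linearP.
by apply: tlift_comb => c d; rewrite /= /tau23_pure3 linearP.
Qed.
HB.instance Definition _ := bilinear_isBilinear.Build k (A ⊗ B)%type
  (C ⊗ D)%type target *:%R *:%R tau23_pure tau23_pure_bilinear.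

Definition tau23 : {linear ((A ⊗ B) ⊗ (C ⊗ D))%type -> target} :=
  tlift tau23_pure.
Lemma tau23E a b c d : tau23 ((a ⊗ b) ⊗ (c ⊗ d)) = (a ⊗ c) ⊗ (b ⊗ d).
Proof.
by rewrite [LHS]tliftE [LHS]tliftE [LHS]tliftE.
Qed.
End Exchange.

Section Unitors.
Variable V : lmodType k.

Definition tunitl_pure (a : k^o) (v : V) : V := a *: v.
Lemma tunitl_pure_bilinear : bilinear_for *:%R *:%R tunitl_pure.
Proof.
split=> [v|u] a x y; rewrite /tunitl_pure.
- rewrite scalerDl; congr (_ + _); exact/esym/scalerA.
- rewrite scalerDr; congr (_ + _); rewrite scalerA mulrC; exact/esym/scalerA.
Qed.
HB.instance Definition _ := bilinear_isBilinear.Build k k^o V V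
  *:%R *:%R tunitl_pure tunitl_pure_bilinear.
Definition tunitl : {linear (k^o ⊗ V)%type -> V} := tlift tunitl_pure.
Lemma tunitlE a v : tunitl (a ⊗ v) = a *: v.
Proof. exact: tliftE. Qed.

Definition tunitr_pure (v : V) (a : k^o) : V := a *: v.
Lemma tunitr_pure_bilinear : bilinear_for *:%R *:%R tunitr_pure.
Proof.
split=> [u|v] a x y; rewrite /tunitr_pure.
- rewrite scalerDr; congr (_ + _); rewrite scalerA mulrC; exact/esym/scalerA.
- rewrite scalerDl; congr (_ + _); exact/esym/scalerA.
Qed.
HB.instance Definition _ := bilinear_isBilinear.Build k V k^o V
  *:%R *:%R tunitr_pure tunitr_pure_bilinear.
Definition tunitr : {linear (V ⊗ k^o)%type -> V} := tlift tunitr_pure.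
Lemma tunitrE a v : tunitr (v ⊗ a) = a *: v.
Proof. exact: tliftE. Qed.
End Unitors.

End TensorMaps.

Record bij (X Y : finType) := Bij {
  bij_fun :> X -> Y;
  bij_inv : Y -> X;
  bij_funK : cancel bij_fun bij_inv;
  bij_invK : cancel bij_inv bij_fun }.

Lemma bij_eq (X Y : finType) (f g : bij X Y) : f =1 g -> f = g.
Proof.
case: f g => [f f' fK f'K] [g g' gK g'K] /= /funext fg; subst g.
have e : f' = g' by apply/funext => y; apply: (can_inj fK); rewrite f'K g'K.
by subst g'; congr Bij; exact: Prop_irrelevance.
Qed.

Definition id_bij (X : finType) : bij X X := @Bij X X id id (frefl _) (frefl _).
Definition sym_bij (X Y : finType) (f : bij X Y) : bij Y X :=
  Bij (bij_invK f) (bij_funK f).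
Definition comp_bij (X Y Z : finType) (g : bij Y Z) (f : bij X Y) : bij X Z :=
  Bij (can_comp (bij_funK g) (bij_funK f)) (can_comp (bij_invK f) (bij_invK g)).

Lemma bijf_inj (X Y : finType) (f : bij X Y) : injective f.
Proof. exact: can_inj (bij_funK f). Qed.

Section BijOfSurj.
Variables (X Y : finType) (f : X -> Y) (fI : injective f).
Hypothesis fS : forall y, exists x, f x == y.
Fact mkbij_invK : cancel (fun y => xchoose (fS y)) f.
Proof. by move=> y; apply/eqP; exact: (xchooseP (fS y)). Qed.
Fact mkbij_funK : cancel f (fun y => xchoose (fS y)).
Proof. by move=> x; apply: fI; rewrite mkbij_invK. Qed.
Definition mkbij : bij X Y := Bij mkbij_funK mkbij_invK.
End BijOfSurj.

(* contravariant functors from finite sets with bijections to vector spaces *)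
Record species (k : fieldType) := Species {
  sp_obj :> finType -> lmodType k;
  sp_map : forall X Y : finType, bij X Y -> {linear sp_obj Y -> sp_obj X};
  sp_map_id : forall X x, sp_map (id_bij X) x = x;
  sp_map_comp : forall (X Y Z : finType) (g : bij Y Z) (f : bij X Y) z,
    sp_map (comp_bij g f) z = sp_map f (sp_map g z) }.
Arguments sp_map {k} s {X Y} f.

Definition species_morphism (k : fieldType) (E F : species k)
    (phi : forall X : finType, {linear E X -> F X}) : Prop :=
  forall (X Y : finType) (f : bij X Y) (y : E Y),
    phi X (sp_map E f y) = sp_map F f (phi Y y).

Section Hadamard.
Variables (k : fieldType) (E F : species k).

Definition hadamard_obj (X : finType) : lmodType k := (E X ⊗ F X)%type.
Definition hadamard_map (X Y : finType) (f : bij X Y) :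
    {linear hadamard_obj Y -> hadamard_obj X} :=
  tmap (sp_map E f) (sp_map F f).

Lemma hadamard_map_id X x : hadamard_map (id_bij X) x = x.
Proof. by apply: tmap_id => v; rewrite sp_map_id. Qed.

Lemma hadamard_map_comp (X Y Z : finType) (g : bij Y Z) (f : bij X Y) z :
  hadamard_map (comp_bij g f) z = hadamard_map f (hadamard_map g z).
Proof. by apply: tmap_comp => v; rewrite sp_map_comp. Qed.

Definition hadamard : species k :=
  @Species k hadamard_obj hadamard_map hadamard_map_id hadamard_map_comp.
End Hadamard.

(* unit of the Hadamard tensor product: the target of counits *)
Definition hadamard_unit (k : fieldType) : species k :=
  @Species k (fun=> k^o) (fun _ _ _ => idfun) (fun _ _ => erefl)
    (fun _ _ _ _ _ _ => erefl).

(* a finite direct sum, encoded as a dependent product *)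
Section DirectSum.
Variables (k : fieldType) (I : finType) (V : I -> lmodType k).

Definition dirsum := {dffun forall i, V i}.
HB.instance Definition _ := Choice.on dirsum.
Implicit Types (u v w : dirsum).

Definition dirsum_zero : dirsum := [ffun i => 0 : V i].
Definition dirsum_opp u : dirsum := [ffun i => - u i : V i].
Definition dirsum_add u v : dirsum := [ffun i => u i + v i : V i].
Definition dirsum_scale a u : dirsum := [ffun i => a *: u i : V i].

Fact dirsum_addA : associative dirsum_add.
Proof. by move=> u v w; apply/ffunP=> i; rewrite !ffunE addrA. Qed.
Fact dirsum_addC : commutative dirsum_add.
Proof. by move=> u v; apply/ffunP=> i; rewrite !ffunE addrC. Qed.
Fact dirsum_add0 : left_id dirsum_zero dirsum_add.
Proof. by move=> u; apply/ffunP=> i; rewrite !ffunE add0r. Qed.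
Fact dirsum_addN : left_inverse dirsum_zero dirsum_opp dirsum_add.
Proof. by move=> u; apply/ffunP=> i; rewrite !ffunE addNr. Qed.
HB.instance Definition _ :=
  GRing.isZmodule.Build dirsum dirsum_addA dirsum_addC dirsum_add0 dirsum_addN.

Fact dirsum_scaleA a b u :
  dirsum_scale a (dirsum_scale b u) = dirsum_scale (a * b) u.
Proof. by apply/ffunP=> i; rewrite !ffunE scalerA. Qed.
Fact dirsum_scale1 : left_id 1 dirsum_scale.
Proof. by move=> u; apply/ffunP=> i; rewrite !ffunE scale1r. Qed.
Fact dirsum_scaleDr : right_distributive dirsum_scale +%R.
Proof. by move=> a u v; apply/ffunP=> i; rewrite !ffunE scalerDr. Qed.
Fact dirsum_scaleDl u : {morph dirsum_scale^~ u : a b / a + b}.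
Proof. by move=> a b; apply/ffunP=> i; rewrite !ffunE scalerDl. Qed.
HB.instance Definition _ := GRing.Zmodule_isLmodule.Build k dirsum
  dirsum_scaleA dirsum_scale1 dirsum_scaleDr dirsum_scaleDl.

Definition dirsum_inj (i : I) (x : V i) : dirsum :=
  finfun (dfwith (fun j => 0 : V j) x).
Fact dirsum_inj_is_linear i : linear (@dirsum_inj i).
Proof.
move=> a x y; apply/ffunP=> j; rewrite !ffunE.
case: (eqVneq i j) => [<-|ij]; first by rewrite !dfwith_in.
by rewrite !dfwith_out // scaler0 addr0.
Qed.
HB.instance Definition _ i :=
  GRing.isLinear.Build k (V i) dirsum *:%R (@dirsum_inj i)
    (@dirsum_inj_is_linear i).
End DirectSum.
Arguments dirsum_inj {k I V} i x.

Definition subfin (A : finType) (I : {set A}) : finType := {x : A | x \in I}.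
Definition in_subfin (A : finType) (I : {set A}) x (xI : x \in I) : subfin I :=
  exist (fun x => x \in I) x xI.

Section SubBij.
Variables (A B : finType) (f : bij A B) (I : {set A}) (J : {set B}).
Hypothesis fIJ : forall x, (f x \in J) = (x \in I).

Fact subbij_to_proof (x : subfin I) : f (val x) \in J.
Proof. by rewrite fIJ; exact: valP. Qed.
Fact subbij_from_proof (y : subfin J) : bij_inv f (val y) \in I.
Proof. by rewrite -fIJ bij_invK; exact: valP. Qed.
Definition subbij_to (x : subfin I) : subfin J := in_subfin (subbij_to_proof x).
Definition subbij_from (y : subfin J) : subfin I :=
  in_subfin (subbij_from_proof y).
Fact subbij_toK : cancel subbij_to subbij_from.
Proof. by move=> x; apply: val_inj; rewrite /= bij_funK. Qed.
Fact subbij_fromK : cancel subbij_from subbij_to.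
Proof. by move=> x; apply: val_inj; rewrite /= bij_invK. Qed.
Definition subbij : bij (subfin I) (subfin J) := Bij subbij_toK subbij_fromK.
End SubBij.

Section Restriction.
Variables (A B : finType) (f : bij A B) (I : {set A}).

Fact bij_mem_img x : (f x \in f @: I) = (x \in I).
Proof. exact: mem_imset (@bijf_inj _ _ f). Qed.
Fact bij_mem_imgC x : (f x \in ~: (f @: I)) = (x \in ~: I).
Proof. by rewrite !inE bij_mem_img. Qed.

Definition bij_restr : bij (subfin I) (subfin (f @: I)) := subbij bij_mem_img.
Definition bij_restrC : bij (subfin (~: I)) (subfin (~: (f @: I))) :=
  subbij bij_mem_imgC.
End Restriction.

Section Cauchy.
Variables (k : fieldType) (E F : species k).

Definition cauchy_obj (A : finType) : lmodType k :=
  dirsum (fun I : {set A} => (E (subfin I) ⊗ F (subfin (~: I)))%type : lmodType k).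

Definition cauchy_map_fun (A B : finType) (f : bij A B) (u : cauchy_obj B) :
    cauchy_obj A :=
  [ffun I : {set A} =>
    tmap (sp_map E (bij_restr f I)) (sp_map F (bij_restrC f I)) (u (f @: I))
    : (E (subfin I) ⊗ F (subfin (~: I)))%type].

Fact cauchy_map_is_linear (A B : finType) (f : bij A B) :
  linear (cauchy_map_fun f).
Proof. by move=> a u v; apply/ffunP=> I; rewrite !ffunE linearP. Qed.
HB.instance Definition _ (A B : finType) (f : bij A B) :=
  GRing.isLinear.Build k (cauchy_obj B) (cauchy_obj A) *:%R (cauchy_map_fun f)
    (cauchy_map_is_linear f).

Definition cauchy_map (A B : finType) (f : bij A B) :
  {linear cauchy_obj B -> cauchy_obj A} := cauchy_map_fun f.

Lemma cauchy_transport (A B : finType) (I : {set A}) (J J' : {set B})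
    (g : bij (subfin I) (subfin J)) (h : bij (subfin (~: I)) (subfin (~: J)))
    (g' : bij (subfin I) (subfin J')) (h' : bij (subfin (~: I)) (subfin (~: J')))
    (u : cauchy_obj B) :
  J = J' -> (forall x, val (g x) = val (g' x)) ->
  (forall x, val (h x) = val (h' x)) ->
  tmap (sp_map E g) (sp_map F h) (u J) = tmap (sp_map E g') (sp_map F h') (u J').
Proof.
move=> eJ; case: _ / eJ g' h' => g' h' eg eh.
have -> : g' = g by apply: bij_eq => x; apply: val_inj.
by have -> : h' = h by apply: bij_eq => x; apply: val_inj.
Qed.

Lemma cauchy_map_id A u : cauchy_map (id_bij A) u = u.
Proof.
apply/ffunP=> I; rewrite ffunE.
rewrite (@cauchy_transport _ _ _ _ I _ _ (id_bij _) (id_bij _)) ?imset_id //.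
by apply: tmap_id => v; rewrite sp_map_id.
Qed.

Lemma cauchy_map_comp (A B C : finType) (g : bij B C) (f : bij A B) u :
  cauchy_map (comp_bij g f) u = cauchy_map f (cauchy_map g u).
Proof.
apply/ffunP=> I; rewrite !ffunE.
rewrite -(@tmap_comp _ _ _ _ _ _ _ _ _
  (sp_map E (comp_bij (bij_restr g (f @: I)) (bij_restr f I))) _ _
  (sp_map F (comp_bij (bij_restrC g (f @: I)) (bij_restrC f I)))) => [|v|v];
  rewrite ?sp_map_comp //.
by apply: cauchy_transport => //; rewrite -imset_comp.
Qed.

Definition cauchy : species k :=
  @Species k cauchy_obj cauchy_map cauchy_map_id cauchy_map_comp.

End Cauchy.

(* In [cauchy P P (X + Y)], the term [P X ⊗ P Y] is the summand indexed by the
   subset [inl_set X Y], i.e. by the copy of [X] in [X + Y]. *)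
Section SumSubsets.
Variables X Y : finType.

Definition inl_set : {set (X + Y)%type} :=
  [set z | if z is inl _ then true else false].

Fact inl_set_proof (x : X) : inl x \in inl_set. Proof. by rewrite inE. Qed.
Fact inr_set_proof (y : Y) : inr y \in ~: inl_set. Proof. by rewrite !inE. Qed.

Definition to_inl (x : X) : subfin inl_set := in_subfin (inl_set_proof x).
Definition to_inr (y : Y) : subfin (~: inl_set) :=
  in_subfin (inr_set_proof y).

Fact to_inl_inj : injective to_inl.
Proof. by move=> x x' [] ->. Qed.
Fact to_inr_inj : injective to_inr.
Proof. by move=> y y' [] ->. Qed.
Fact to_inl_surj z : exists x, to_inl x == z.
Proof.
case: z => [[x|y] h]; first by exists x; apply/eqP/val_inj.
by exfalso; move: h; rewrite inE.
Qed.
Fact to_inr_surj z : exists y, to_inr y == z.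
Proof.
case: z => [[x|y] h]; last by exists y; apply/eqP/val_inj.
by exfalso; move: h; rewrite !inE.
Qed.

Definition inl_bij : bij X (subfin inl_set) := mkbij to_inl_inj to_inl_surj.
Definition inr_bij : bij Y (subfin (~: inl_set)) := mkbij to_inr_inj to_inr_surj.
End SumSubsets.

Section SumBij.
Variables X Y Z : finType.

Definition sumA_fun (z : (X + Y) + Z) : X + (Y + Z) :=
  match z with
  | inl (inl x) => inl x | inl (inr y) => inr (inl y) | inr z => inr (inr z)
  end.
Definition sumA_inv (z : X + (Y + Z)) : (X + Y) + Z :=
  match z with
  | inl x => inl (inl x) | inr (inl y) => inl (inr y) | inr (inr z) => inr z
  end.
Fact sumA_funK : cancel sumA_fun sumA_inv. Proof. by case=> [[]|]. Qed.
Fact sumA_invK : cancel sumA_inv sumA_fun. Proof. by case=> [|[]]. Qed.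
Definition sumA_bij : bij ((X + Y) + Z)%type (X + (Y + Z))%type :=
  Bij sumA_funK sumA_invK.

Definition sumC_fun (X Y : Type) (z : X + Y) : Y + X :=
  match z with inl x => inr x | inr y => inl y end.
Fact sumC_funK (A B : Type) : cancel (@sumC_fun A B) (@sumC_fun B A).
Proof. by case. Qed.
Definition sumC_bij : bij (X + Y)%type (Y + X)%type :=
  Bij (@sumC_funK X Y) (@sumC_funK Y X).

Definition sum0l_fun (z : void + X) : X :=
  match z with inl v => of_void X v | inr x => x end.
Fact sum0l_funK : cancel sum0l_fun inr. Proof. by case. Qed.
Definition sum0l_bij : bij (void + X)%type X := Bij sum0l_funK (frefl _).

Definition sum0r_fun (z : X + void) : X :=
  match z with inl x => x | inr v => of_void X v end.
Fact sum0r_funK : cancel sum0r_fun inl. Proof. by case. Qed.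
Definition sum0r_bij : bij (X + void)%type X := Bij sum0r_funK (frefl _).
End SumBij.

Section TwistedBialgebra.
Variables (k : fieldType) (P : species k).
Variable m : forall A : finType, {linear cauchy P P A -> P A}.
Variable Gamma : forall X : finType, {linear P X -> hadamard P P X}.

(* [m] on [P X ⊗ P Y], for [X] and [Y] disjoint *)
Definition product (X Y : finType) : {linear (P X ⊗ P Y)%type -> P (X + Y)%type} :=
  m (X + Y)%type \o (dirsum_inj (inl_set X Y)
    \o tmap (sp_map P (sym_bij (inl_bij X Y))) (sp_map P (sym_bij (inr_bij X Y)))).

(* The unit of the Cauchy tensor product is the species equal to [k] on the
   empty set and to 0 elsewhere; a species morphism from it to [P] is an element
   [u] of [P void]. *)
Record twisted_bialgebra_axioms (u : P void)
    (eps : forall X : finType, {linear P X -> hadamard_unit k X}) : Prop := {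
  product_species_morphism : species_morphism m;
  coproduct_species_morphism : species_morphism Gamma;
  counit_species_morphism : species_morphism eps;
  product_assoc : forall (X Y Z : finType) (x : P X) (y : P Y) (z : P Z),
    product (X + Y)%type Z (product X Y (x ⊗ y) ⊗ z) =
    sp_map P (sumA_bij X Y Z) (product X (Y + Z)%type (x ⊗ product Y Z (y ⊗ z)));
  product_unitl : forall (X : finType) (x : P X),
    product void X (u ⊗ x) = sp_map P (sum0l_bij X) x;
  product_unitr : forall (X : finType) (x : P X),
    product X void (x ⊗ u) = sp_map P (sum0r_bij X) x;
  coproduct_coassoc : forall (X : finType) (x : P X),
    tassoc _ _ _ (tmap (Gamma X) idfun (Gamma X x)) =
    tmap idfun (Gamma X) (Gamma X x);
  coproduct_counitl : forall (X : finType) (x : P X),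
    tunitl _ (tmap (eps X) idfun (Gamma X x)) = x;
  coproduct_counitr : forall (X : finType) (x : P X),
    tunitr _ (tmap idfun (eps X) (Gamma X x)) = x;
  coproduct_product : forall (X Y : finType) (x : P X) (y : P Y),
    Gamma (X + Y)%type (product X Y (x ⊗ y)) =
    tmap (product X Y) (product X Y)
      (tau23 _ _ _ _ (Gamma X x ⊗ Gamma Y y));
  coproduct_unit : Gamma void u = u ⊗ u;
  counit_product : forall (X Y : finType) (x : P X) (y : P Y),
    eps (X + Y)%type (product X Y (x ⊗ y)) = eps X x * eps Y y :> k;
  counit_unit : eps void u = 1 :> k }.

Definition twisted_bialgebra : Prop :=
  exists (u : P void) (eps : forall X : finType, {linear P X -> hadamard_unit k X}),
    twisted_bialgebra_axioms u eps.

Definition product_commutative : Prop :=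
  forall (X Y : finType) (x : P X) (y : P Y),
    product X Y (x ⊗ y) = sp_map P (sumC_bij X Y) (product Y X (y ⊗ x)).

Definition commutative_twisted_bialgebra : Prop :=
  twisted_bialgebra /\ product_commutative.
End TwistedBialgebra.

Section Topology.
Variable X : finType.

(* A topology on a finite set is represented by its quasi-order:
   [top_le T x y] iff every open set containing [x] contains [y], see
   [top_leE]; the open sets are the up-closed sets. *)
Definition topology_axiom (r : {ffun X * X -> bool}) : bool :=
  [forall x, r (x, x)]
  && [forall x, forall y, forall z, r (x, y) ==> r (y, z) ==> r (x, z)].

Record topology : predArgType :=
  Topology { top_rel : {ffun X * X -> bool}; _ : topology_axiom top_rel }.
HB.instance Definition _ := [isSub for top_rel].
HB.instance Definition _ := [Finite of topology by <:].

Definition top_le (T : topology) : rel X := fun x y => top_rel T (x, y).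

Lemma top_refl T : reflexive (top_le T).
Proof. by move=> x; case: T => r p; case/andP: (p) => /forallP rr _; exact: rr. Qed.

Lemma top_trans T : transitive (top_le T).
Proof.
move=> y x z; case: T => r p; case/andP: (p) => _ /forallP rt.
have /forallP/(_ y)/forallP/(_ z)/implyP h := rt x.
by move=> xy; apply/implyP/h.
Qed.

Fact mktop_proof (r : rel X) : reflexive r -> transitive r ->
  topology_axiom [ffun p => r p.1 p.2].
Proof.
move=> rr rt; apply/andP; split; first by apply/forallP => x; rewrite ffunE.
do 3![apply/forallP => ?]; rewrite !ffunE /=.
by apply/implyP => xy; apply/implyP; exact: rt.
Qed.
Definition mktop (r : rel X) (rr : reflexive r) (rt : transitive r) : topology :=
  Topology (mktop_proof rr rt).

Lemma mktopE r rr rt : top_le (@mktop r rr rt) =2 r.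
Proof. by move=> x y; rewrite /top_le ffunE. Qed.

Lemma topologyP (T T' : topology) : top_le T =2 top_le T' -> T = T'.
Proof. by move=> e; apply/val_inj/ffunP => -[x y]; exact: e. Qed.

Definition open (T : topology) (U : {set X}) : bool :=
  [forall x, forall y, (x \in U) && top_le T x y ==> (y \in U)].

Lemma openP T (U : {set X}) :
  reflect (forall x y, x \in U -> top_le T x y -> y \in U) (open T U).
Proof.
apply: (iffP forallP) => [h x y xU xy|h x].
  by have /forallP/(_ y)/implyP -> := h x; rewrite ?xU.
by apply/forallP => y; apply/implyP => /andP[]; exact: h.
Qed.

Definition top_up T x : {set X} := [set y | top_le T x y].
Lemma open_up T x : open T (top_up T x).
Proof. by apply/openP => y z; rewrite !inE; exact: top_trans. Qed.

Lemma top_leE T x y :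
  top_le T x y = [forall U, open T U ==> (x \in U) ==> (y \in U)].
Proof.
apply/idP/forallP => [xy U|/(_ (top_up T x))].
  by apply/implyP => /openP oU; apply/implyP => /oU; exact.
by rewrite open_up !inE top_refl.
Qed.

Definition top_sim (T : topology) : rel X :=
  fun x y => top_le T x y && top_le T y x.

Definition connected (T : topology) : bool :=
  [forall U, open T U && open T (~: U) ==> (U == set0) || (U == setT)].

(* [T' ≺ T] *)
Definition finer (T' T : topology) : bool :=
  [forall x, forall y, top_le T' x y ==> top_le T x y].

(* [connect] is the reflexive transitive closure; the relation is reflexive *)
Definition top_quot (T T' : topology) : topology :=
  @mktop (connect [rel x y | top_le T x y || top_le T' y x])
    (@connect0 _ _) (@connect_trans _ _).
End Topology.

Definition subspace (X : finType) (T : topology X) (Y : {set X}) :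
    topology (subfin Y) :=
  @mktop (subfin Y) (fun x y => top_le T (val x) (val y))
    (fun x => top_refl T (val x))
    (fun y x z => @top_trans X T (val y) (val x) (val z)).

(* the relation written with a circled ≺ *)
Definition admissible (X : finType) (T' T : topology X) : bool :=
  [&& finer T' T,
      [forall Y : {set X}, connected (subspace T' Y) ==>
                           (subspace T' Y == subspace T Y)]
    & [forall x, forall y,
         top_sim (top_quot T T') x y == top_sim (top_quot T' T') x y]].

Section Continuity.
Variables X Y : finType.

Fact top_prod_refl (T : topology X) (S : topology Y) :
  reflexive (fun p q : X * Y => top_le T p.1 q.1 && top_le S p.2 q.2).
Proof. by move=> p; rewrite !top_refl. Qed.
Fact top_prod_trans (T : topology X) (S : topology Y) :
  transitive (fun p q : X * Y => top_le T p.1 q.1 && top_le S p.2 q.2).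
Proof.
move=> q p r /andP[a b] /andP[c d].
by rewrite (top_trans a c) (top_trans b d).
Qed.
Definition top_prod (T : topology X) (S : topology Y) : topology (X * Y)%type :=
  mktop (@top_prod_refl T S) (@top_prod_trans T S).

Lemma open_prodP T S (W : {set X * Y}) :
  reflect (forall p, p \in W -> exists U V,
             [/\ open T U, open S V, p \in setX U V & setX U V \subset W])
          (open (top_prod T S) W).
Proof.
apply: (iffP (openP _ _)) => [h p pW|h p q /h[U [V [oU oV]]]].
- exists (top_up T p.1), (top_up S p.2); split; rewrite ?open_up //.
    by case: p pW => x y _; rewrite !inE !top_refl.
  apply/subsetP => q qq; apply: (h p) => //.
  by rewrite mktopE; case: q qq => x y; rewrite !inE.
- case: p q => [x y] [x' y']; rewrite mktopE !inE /= => /andP[xU yV] /subsetP UV.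
  move=> /andP[xx yy]; apply: UV; rewrite !inE /=.
  by rewrite (openP _ _ oU _ _ xU xx) (openP _ _ oV _ _ yV yy).
Qed.

Definition continuous_map (T : topology X) (S : topology Y) (f : X -> Y) : bool :=
  [forall V : {set Y}, open S V ==> open T (f @^-1: V)].

Lemma continuousP T S f :
  reflect {homo f : x y / top_le T x y >-> top_le S x y} (continuous_map T S f).
Proof.
apply: (iffP forallP) => [h x y xy|h V].
  have /implyP/(_ (open_up _ _))/openP/(_ x y) := h (top_up S (f x)).
  by rewrite !inE top_refl; apply.
apply/implyP => /openP oV; apply/openP => x y; rewrite !inE => fx /h.
exact: oV.
Qed.
End Continuity.

Definition homeomorphism (X Y : finType) (T : topology X) (S : topology Y)
    (f : X -> Y) : Prop :=
  exists g : Y -> X, [/\ cancel f g, cancel g f,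
                         continuous_map T S f & continuous_map S T g].

Section Quandle.
Variable X : finType.

Definition quandle_axiom (q : {ffun X * X -> X}) : bool :=
  [&& [forall a, q (a, a) == a],
      [forall a, forall b, exists c, (a == q (c, b)) &&
         [forall c', (a == q (c', b)) ==> (c' == c)]]
    & [forall a, forall b, forall c,
         q (q (a, b), c) == q (q (a, c), q (b, c))]].

Record quandle : predArgType :=
  Quandle { quandle_op : {ffun X * X -> X}; _ : quandle_axiom quandle_op }.
HB.instance Definition _ := [isSub for quandle_op].
HB.instance Definition _ := [Finite of quandle by <:].

Definition qop (Q : quandle) (a b : X) : X := quandle_op Q (a, b).

Lemma qop_idem Q a : qop Q a a = a.
Proof. by case: Q => q p; case/and3P: (p) => /forallP h _ _; apply/eqP/h. Qed.

Lemma qop_inj Q b : injective (qop Q ^~ b).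
Proof.
case: Q => q p; case/and3P: (p) => _ /forallP h _ x y; rewrite /qop /= => e.
have /forallP/(_ b)/existsP[c /andP[_ /forallP u]] := h (q (x, b)).
have /eqP -> := implyP (u x) (eqxx _).
by apply/esym/eqP/(implyP (u y)); rewrite e.
Qed.

Lemma qop_dist Q a b c : qop Q (qop Q a b) c = qop Q (qop Q a c) (qop Q b c).
Proof.
case: Q => q p; case/and3P: (p) => _ _ /forallP h.
by have /forallP/(_ b)/forallP/(_ c)/eqP := h a.
Qed.

Fact mkquandle_proof (f : X -> X -> X) :
  (forall a, f a a = a) -> (forall b, injective (f^~ b)) ->
  (forall a b c, f (f a b) c = f (f a c) (f b c)) ->
  quandle_axiom [ffun p => f p.1 p.2].
Proof.
move=> f1 f2 f3; apply/and3P; split.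
- by apply/forallP => a; rewrite ffunE f1.
- apply/forallP => a; apply/forallP => b; apply/existsP.
  exists (invF (f2 b) a); rewrite ffunE /= (f_invF (f2 b)) eqxx /=.
  apply/forallP => c; rewrite ffunE /=; apply/implyP => /eqP ->.
  by rewrite (invF_f (f2 b)).
- by do 3![apply/forallP => ?]; rewrite !ffunE /= f3.
Qed.
Definition mkquandle f f1 f2 f3 : quandle := Quandle (@mkquandle_proof f f1 f2 f3).

Lemma mkquandleE f f1 f2 f3 : qop (@mkquandle f f1 f2 f3) =2 f.
Proof. by move=> a b; rewrite /qop ffunE. Qed.

Lemma quandleP (Q Q' : quandle) : qop Q =2 qop Q' -> Q = Q'.
Proof. by move=> e; apply/val_inj/ffunP => -[x y]; exact: e. Qed.

Definition compatible (Q : quandle) (T : topology X) : bool :=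
  `[< continuous_map (top_prod T T) T (fun p => qop Q p.1 p.2)
      /\ forall b, homeomorphism T T (qop Q ^~ b) >].

Lemma compatibleP Q T :
  reflect (forall x x' y y', top_le T x x' -> top_le T y y' ->
             top_le T (qop Q x y) (qop Q x' y'))
          (compatible Q T).
Proof.
apply: (iffP (asboolP _)) => [[/continuousP h _] x x' y y' xx yy|h].
  by apply: (h (x, y) (x', y')); rewrite mktopE /= xx.
split; first by apply/continuousP => -[x y] [x' y']; rewrite mktopE => /andP[]; exact: h.
move=> b; pose f := qop Q ^~ b; pose p := perm (@qop_inj Q b).
have hp : {homo p : x y / top_le T x y} by move=> x y xy; rewrite !permE h ?top_refl.
exists (p^-1)%g; split.
- by move=> x; rewrite -[qop Q x b](permE (@qop_inj Q b)) permK.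
- by move=> x; rewrite -[LHS](permE (@qop_inj Q b)) permKV.
- by apply/continuousP => x y xy; rewrite h ?top_refl.
- apply/continuousP => x y xy; rewrite invg_expg !permX.
  by elim: #[p]%g.-1 => //= n IHn; exact: hp.
Qed.

Record compatible_topology (Q : quandle) : predArgType :=
  CompatibleTopology { ct_top : topology X; _ : compatible Q ct_top }.
HB.instance Definition _ Q := [isSub for @ct_top Q].
HB.instance Definition _ Q := [Finite of compatible_topology Q by <:].

Record top_quandle : predArgType :=
  TopQuandle { tq_pair : quandle * topology X; _ : compatible tq_pair.1 tq_pair.2 }.
HB.instance Definition _ := [isSub for tq_pair].
HB.instance Definition _ := [Finite of top_quandle by <:].

Definition tq_quandle (s : top_quandle) : quandle := (tq_pair s).1.
Definition tq_top (s : top_quandle) : topology X := (tq_pair s).2.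

Definition tq_ctop (s : top_quandle) : compatible_topology (tq_quandle s) :=
  CompatibleTopology (valP s).
Definition tq_of (Q : quandle) (T : compatible_topology Q) : top_quandle :=
  @TopQuandle (Q, ct_top T) (valP T).

Lemma top_quandleP (s s' : top_quandle) :
  qop (tq_quandle s) =2 qop (tq_quandle s') ->
  top_le (tq_top s) =2 top_le (tq_top s') -> s = s'.
Proof.
case: s s' => [[Q T] c] [[Q' T'] c'] /= /quandleP eQ /topologyP eT.
by apply: val_inj; rewrite /= -[Q]/(tq_quandle (TopQuandle c)) eQ
  -[T]/(tq_top (TopQuandle c)) eT.
Qed.

Lemma compatible_quot (Q : quandle) (T T' : topology X) :
  compatible Q T -> compatible Q T' -> compatible Q (top_quot T T').
Proof.
move=> /compatibleP cT /compatibleP cT'; apply/compatibleP => x x' y y'.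
rewrite !mktopE; set r := [rel _ _ | _] => xx yy.
have rl z u v : connect r u v -> connect r (qop Q u z) (qop Q v z).
  move=> /connectP[p rp ->]; elim: p u rp => [|w p IHp] u /=.
    by move=> _; exact: connect0.
  move=> /andP[uw /IHp]; apply: connect_trans; apply: connect1.
  by apply/orP; case/orP: uw => h; [left; apply: cT|right; apply: cT'];
    rewrite ?top_refl.
have rr z u v : connect r u v -> connect r (qop Q z u) (qop Q z v).
  move=> /connectP[p rp ->]; elim: p u rp => [|w p IHp] u /=.
    by move=> _; exact: connect0.
  move=> /andP[uw /IHp]; apply: connect_trans; apply: connect1.
  by apply/orP; case/orP: uw => h; [left; apply: cT|right; apply: cT'];
    rewrite ?top_refl.
exact: connect_trans (rl _ _ _ xx) (rr _ _ _ yy).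
Qed.

Definition ct_quot (Q : quandle) (T T' : compatible_topology Q) :
    compatible_topology Q :=
  CompatibleTopology (compatible_quot (valP T) (valP T')).
End Quandle.

Section Relabel.
Variables (X Y : finType) (f : bij X Y).

Definition top_pull (T : topology Y) : topology X :=
  @mktop X (fun x y => top_le T (f x) (f y))
    (fun x => top_refl T (f x)) (fun y x z => @top_trans Y T (f y) (f x) (f z)).

Section Pull.
Variable Q : quandle Y.
Definition pull_op (a b : X) : X := bij_inv f (qop Q (f a) (f b)).
Fact pull_op_idem a : pull_op a a = a.
Proof. by rewrite /pull_op qop_idem bij_funK. Qed.
Fact pull_op_inj b : injective (pull_op^~ b).
Proof.
move=> x y e; apply: (@bijf_inj _ _ f).
exact: (@qop_inj _ Q (f b) (f x) (f y)) (can_inj (bij_invK f) e).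
Qed.
Fact pull_op_dist a b c :
  pull_op (pull_op a b) c = pull_op (pull_op a c) (pull_op b c).
Proof. by rewrite /pull_op !bij_invK qop_dist. Qed.
Definition quandle_pull : quandle X :=
  mkquandle pull_op_idem (@pull_op_inj) pull_op_dist.
End Pull.

Fact compatible_pull Q T :
  compatible Q T -> compatible (quandle_pull Q) (top_pull T).
Proof.
move=> /compatibleP c; apply/compatibleP => x x' y y'.
by rewrite !mktopE !mkquandleE /pull_op !bij_invK; exact: c.
Qed.

Definition tq_pull (s : top_quandle Y) : top_quandle X :=
  @TopQuandle X (quandle_pull (tq_quandle s), top_pull (tq_top s))
    (compatible_pull (valP s)).

Lemma tq_pull_opE s a b :
  qop (tq_quandle (tq_pull s)) a b = bij_inv f (qop (tq_quandle s) (f a) (f b)).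
Proof. exact: mkquandleE. Qed.
Lemma tq_pull_leE s a b :
  top_le (tq_top (tq_pull s)) a b = top_le (tq_top s) (f a) (f b).
Proof. exact: mktopE. Qed.
End Relabel.

Section DisjointUnion.
Variables X1 X2 : finType.

Section TopSum.
Variables (T1 : topology X1) (T2 : topology X2).
Definition sum_le (a b : X1 + X2) : bool :=
  match a, b with
  | inl x, inl y => top_le T1 x y
  | inr x, inr y => top_le T2 x y
  | _, _ => false
  end.
Fact sum_le_refl : reflexive sum_le.
Proof. by case=> x; exact: top_refl. Qed.
Fact sum_le_trans : transitive sum_le.
Proof. by move=> [y|y] [x|x] [z|z] //=; exact: top_trans. Qed.
Definition top_sum : topology (X1 + X2)%type := mktop sum_le_refl sum_le_trans.
End TopSum.

Section QuandleSum.
Variables (Q1 : quandle X1) (Q2 : quandle X2).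
Definition sum_op (a b : X1 + X2) : X1 + X2 :=
  match a, b with
  | inl x, inl y => inl (qop Q1 x y)
  | inr x, inr y => inr (qop Q2 x y)
  | _, _ => a
  end.
Fact sum_op_idem a : sum_op a a = a.
Proof. by case: a => x /=; rewrite qop_idem. Qed.
Fact sum_op_inj b : injective (sum_op^~ b).
Proof. by case: b => b [x|x] [y|y] //= [] /qop_inj ->. Qed.
Fact sum_op_dist a b c : sum_op (sum_op a b) c = sum_op (sum_op a c) (sum_op b c).
Proof. by case: a b c => a [b|b] [c|c] //=; rewrite qop_dist. Qed.
Definition quandle_sum : quandle (X1 + X2)%type :=
  mkquandle sum_op_idem (@sum_op_inj) sum_op_dist.
End QuandleSum.

Fact compatible_sum Q1 Q2 T1 T2 : compatible Q1 T1 -> compatible Q2 T2 ->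
  compatible (quandle_sum Q1 Q2) (top_sum T1 T2).
Proof.
move=> /compatibleP c1 /compatibleP c2; apply/compatibleP => x x' y y'.
rewrite !mktopE !mkquandleE.
by case: x x' y y' => x [x'|x'] [y|y] [y'|y'] //=; [exact: c1|exact: c2].
Qed.

Definition tq_sum (s1 : top_quandle X1) (s2 : top_quandle X2) :
    top_quandle (X1 + X2)%type :=
  @TopQuandle (X1 + X2)%type
    (quandle_sum (tq_quandle s1) (tq_quandle s2), top_sum (tq_top s1) (tq_top s2))
    (compatible_sum (valP s1) (valP s2)).

Lemma tq_sum_opE s1 s2 a b :
  qop (tq_quandle (tq_sum s1 s2)) a b
  = sum_op (tq_quandle s1) (tq_quandle s2) a b.
Proof. exact: mkquandleE. Qed.
Lemma tq_sum_leE s1 s2 a b :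
  top_le (tq_top (tq_sum s1 s2)) a b = sum_le (tq_top s1) (tq_top s2) a b.
Proof. exact: mktopE. Qed.
End DisjointUnion.

Section FreeSpace.
Variables (k : fieldType) (S : finType).
Notation free := {ffun S -> k^o}.

Definition basis (s : S) : free := [ffun s' => (s' == s)%:R].

Section FreeLift.
Variables (V : lmodType k) (h : S -> V).
Definition free_lift_fun (c : free) : V := \sum_s (c s : k) *: h s.
Fact free_lift_is_linear : linear free_lift_fun.
Proof.
move=> a c d; rewrite /free_lift_fun scaler_sumr -big_split.
by apply: eq_bigr => s _; rewrite !ffunE scalerDl scalerA.
Qed.
HB.instance Definition _ :=
  GRing.isLinear.Build k free V *:%R free_lift_fun free_lift_is_linear.
Definition free_lift : {linear free -> V} := free_lift_fun.

Lemma free_liftE s : free_lift (basis s) = h s.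
Proof.
rewrite /free_lift /= /free_lift_fun (bigD1 s) //= ffunE eqxx scale1r.
by rewrite big1 ?addr0 // => t /negPf nts; rewrite ffunE nts scale0r.
Qed.
End FreeLift.

Lemma free_basisE (c : free) : c = \sum_s (c s : k) *: basis s.
Proof.
apply/ffunP => s; rewrite sum_ffunE (bigD1 s) //= !ffunE eqxx.
rewrite big1 ?addr0 => [|t /negPf nts]; first by rewrite [RHS]mulr1.
by rewrite !ffunE eq_sym nts [LHS]mulr0.
Qed.

Lemma free_lin_eq (V : lmodType k) (f g : {linear free -> V}) :
  (forall s, f (basis s) = g (basis s)) -> f =1 g.
Proof.
move=> fg c; rewrite (free_basisE c) !linear_sum; apply: eq_bigr => s _.
by rewrite !linearZ /= fg.
Qed.
End FreeSpace.

Section FreeTensor.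
Variables (k : fieldType) (S T : finType) (V : lmodType k) (h : S -> T -> V).
Definition free_bilift_fun (c : {ffun S -> k^o}) (d : {ffun T -> k^o}) : V :=
  free_lift (fun s => free_lift (h s) d) c.
Fact free_bilift_bilinear : bilinear_for *:%R *:%R free_bilift_fun.
Proof.
split=> [d|c] a x y; rewrite /free_bilift_fun; first by rewrite linearP.
rewrite /free_lift /= /free_lift_fun scaler_sumr -big_split.
apply: eq_bigr => s _.
by rewrite -[X in _ *: X]/(free_lift (h s) _) linearP scalerDr !scalerA mulrC.
Qed.
HB.instance Definition _ := bilinear_isBilinear.Build k _ _ V
  *:%R *:%R free_bilift_fun free_bilift_bilinear.
(* the linear map [basis s ⊗ basis t |-> h s t] *)
Definition free_bilift : {linear ({ffun S -> k^o} ⊗ {ffun T -> k^o})%type -> V} :=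
  tlift free_bilift_fun.
Lemma free_biliftE s t : free_bilift (basis k s ⊗ basis k t) = h s t.
Proof. by rewrite [LHS]tliftE [LHS]free_liftE [LHS]free_liftE. Qed.
End FreeTensor.

Section QT.
Variable k : fieldType.

Definition QT_obj (X : finType) : lmodType k := {ffun top_quandle X -> k^o}.
Definition QT_map (X Y : finType) (f : bij X Y) : {linear QT_obj Y -> QT_obj X} :=
  free_lift (fun s => basis k (tq_pull f s)).

Lemma QT_map_id X x : QT_map (id_bij X) x = x.
Proof.
apply: (free_lin_eq (f := QT_map (id_bij X)) (g := idfun)) => s.
rewrite free_liftE; congr basis.
by apply: top_quandleP => a b; rewrite ?mkquandleE ?mktopE.
Qed.

Lemma QT_map_comp (X Y Z : finType) (g : bij Y Z) (f : bij X Y) z :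
  QT_map (comp_bij g f) z = QT_map f (QT_map g z).
Proof.
apply: (free_lin_eq (f := QT_map (comp_bij g f)) (g := QT_map f \o QT_map g)) => s.
rewrite /= !free_liftE; congr basis.
apply: top_quandleP => a b; rewrite ?mkquandleE ?mktopE //.
by rewrite /pull_op mkquandleE /pull_op.
Qed.

Definition QT : species k := @Species k QT_obj QT_map QT_map_id QT_map_comp.

Definition tq_vect (X : finType) (s : top_quandle X) : QT X := basis k s.

Section Glue.
Variables (A : finType) (I : {set A}).
Definition glue_fun (z : subfin I + subfin (~: I)) : A :=
  match z with inl x => val x | inr y => val y end.
Fact glue_fun_inj : injective glue_fun.
Proof.
move=> [x|x] [y|y] /= e; first by rewrite (val_inj e).
- by case: x y e => [x xI] [y yI] /= e; exfalso; move: yI; rewrite -e inE xI.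
- by case: x y e => [x xI] [y yI] /= e; exfalso; move: xI; rewrite e inE yI.
- by rewrite (val_inj e).
Qed.
Fact glue_fun_surj a : exists z, glue_fun z == a.
Proof.
have [aI|aI] := boolP (a \in I); first by exists (inl (in_subfin aI)).
have aI' : a \in ~: I by rewrite inE.
by exists (inr (in_subfin aI')).
Qed.
Definition glue_bij : bij (subfin I + subfin (~: I))%type A :=
  mkbij glue_fun_inj glue_fun_surj.
End Glue.

(* On the summand indexed by [I], structures [s] on [I] and [t] on [~: I] are sent
   to the structure [tq_sum s t] on their disjoint union, moved to [A] along
   [glue_bij I]; see [QT_mulE]. *)
Definition QT_mul_fun (A : finType) (u : cauchy QT QT A) : QT A :=
  \sum_(I : {set A})
    free_bilift (fun (s : top_quandle (subfin I)) (t : top_quandle (subfin (~: I))) =>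
      tq_vect (tq_pull (sym_bij (glue_bij I)) (tq_sum s t))) (u I).

Fact QT_mul_is_linear A : linear (@QT_mul_fun A).
Proof.
move=> a u v; rewrite /QT_mul_fun scaler_sumr -big_split.
by apply: eq_bigr => I _; rewrite ffunE ffunE linearP.
Qed.
HB.instance Definition _ A :=
  GRing.isLinear.Build k (cauchy QT QT A) (QT A) *:%R (@QT_mul_fun A)
    (@QT_mul_is_linear A).

Definition QT_mul (A : finType) : {linear cauchy QT QT A -> QT A} :=
  @QT_mul_fun A.

Definition QT_coprod (X : finType) : {linear QT X -> hadamard QT QT X} :=
  free_lift (fun s : top_quandle X =>
    \sum_(T' : compatible_topology (tq_quandle s) | admissible (ct_top T') (tq_top s))
      tq_vect (tq_of T') ⊗ tq_vect (tq_of (ct_quot (tq_ctop s) T'))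
    : (QT X ⊗ QT X)%type).

Lemma QT_mulE (X1 X2 : finType) (s1 : top_quandle X1) (s2 : top_quandle X2) :
  product QT_mul X1 X2 (tq_vect s1 ⊗ tq_vect s2) = tq_vect (tq_sum s1 s2).
Proof.
rewrite /product /= tmapE /= !free_liftE /QT_mul_fun (bigD1 (inl_set X1 X2)) //=.
rewrite big1 => [|I nI]; last first.
  by rewrite ffunE dfwith_out 1?eq_sym // linear0.
rewrite addr0 ffunE dfwith_in free_biliftE; congr basis.
pose g := sym_bij (glue_bij (inl_set X1 X2)).
have gl x : g (inl x) = inl (to_inl X2 x).
  exact: (bij_funK (glue_bij (inl_set X1 X2)) (inl (to_inl X2 x))).
have gr y : g (inr y) = inr (to_inr X1 y).
  exact: (bij_funK (glue_bij (inl_set X1 X2)) (inr (to_inr X1 y))).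
have il x : sym_bij (inl_bij X1 X2) (to_inl X2 x) = x.
  exact: (bij_funK (inl_bij X1 X2)).
have ir y : sym_bij (inr_bij X1 X2) (to_inr X1 y) = y.
  exact: (bij_funK (inr_bij X1 X2)).
apply: top_quandleP => a b.
- rewrite tq_pull_opE !tq_sum_opE -/g.
  by case: a b => [x|x] [y|y]; rewrite ?gl ?gr [in LHS]/sum_op
    ?tq_pull_opE ?il ?ir.
- rewrite tq_pull_leE !tq_sum_leE -/g.
  by case: a b => [x|x] [y|y]; rewrite ?gl ?gr [in LHS]/sum_le
    ?tq_pull_leE ?il ?ir.
Qed.

Lemma QT_coprodE (X : finType) (s : top_quandle X) :
  QT_coprod X (tq_vect s) =
  \sum_(T' : compatible_topology (tq_quandle s) | admissible (ct_top T') (tq_top s))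
    tq_vect (tq_of T') ⊗ tq_vect (tq_of (ct_quot (tq_ctop s) T')).
Proof. exact: free_liftE. Qed.
End QT.

(* Main.v *)
Require Import Defs.
From mathcomp Require Import all_boot all_order all_algebra.

(* In terms of quasi-orders, [T'] is admissible in [T] iff [T'] is [T] restricted
   to the connected components of [T'], and every cycle of [T/T'] stays inside
   one such component.  For fixed [T''] admissible in [T], the map
   [T' |-> T'/T''] is then a bijection from the topologies between [T''] and [T]
   onto the topologies admissible in [T/T''], whose inverse intersects [T] with
   the component relation of [U]; together with [(T/T'')/(T'/T'') = T/T'] this is
   coassociativity.  Both the map and its inverse preserve compatibility with the
   quandle.  The counit is 1 on the symmetric quasi-orders and 0 on the others:
   [T'] is symmetric only for [T' = top_sim T], and [T/T'] only for [T' = T]. *)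

Set Implicit Arguments.
Unset Strict Implicit.
Unset Printing Implicit Defensive.

Import GRing.Theory.

Local Open Scope ring_scope.

(** * Quotients of quasi-orders and admissible pairs *)

Section QuotientTopology.
Variable X : finType.
Implicit Types (T S U : topology X) (x y z w : X).

Lemma finerP T' T :
  reflect (forall x y, top_le T' x y -> top_le T x y) (finer T' T).
Proof.
apply: (iffP forallP) => [h x y|h x]; first by have /forallP/(_ y)/implyP := h x.
by apply/forallP => y; apply/implyP; exact: h.
Qed.

Lemma top_quot_l T T' x y : top_le T x y -> top_le (top_quot T T') x y.
Proof. by move=> xy; rewrite mktopE; apply: connect1; rewrite /= xy. Qed.

Lemma top_quot_r T T' x y : top_le T' y x -> top_le (top_quot T T') x y.
Proof. by move=> yx; rewrite mktopE; apply: connect1; rewrite /= yx orbT. Qed.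

(* Induction on a chain from [x] to [y]; only the steps lying between [x] and
   [y] in the quotient are constrained. *)
Lemma top_quot_between T T' S x y :
  (forall z w, top_le (top_quot T T') x z -> top_le (top_quot T T') w y ->
     top_le T z w || top_le T' w z -> top_le S z w) ->
  top_le (top_quot T T') x y -> top_le S x y.
Proof.
move=> h; rewrite mktopE => /connectP[p]; elim: p x h => [|u p IHp] x h /=.
  by move=> _ ->; exact: top_refl.
move=> /andP[xu pth] def_y.
have uy : top_le (top_quot T T') u y by rewrite mktopE; apply/connectP; exists p.
apply: (top_trans (h _ _ (top_refl _ x) uy xu)); apply: IHp => // z w uz wy.
apply: h => //; apply: top_trans uz.
by case/orP: xu => xu; [exact: top_quot_l|exact: top_quot_r].
Qed.

(** Universal property of the quotient; inclusions between quotients follow from it without handling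
    chains. *)
Lemma top_quot_least T T' S x y :
  (forall z w, top_le T z w -> top_le S z w) ->
  (forall z w, top_le T' z w -> top_le S w z) ->
  top_le (top_quot T T') x y -> top_le S x y.
Proof.
move=> hT hT'; apply: top_quot_between => z w _ _ /orP[]; [exact: hT|exact: hT'].
Qed.

(** The universal property read in the opposite order, which saves constructing opposite
    topologies. *)
Lemma top_quot_least_rev T T' S x y :
  (forall z w, top_le T z w -> top_le S w z) ->
  (forall z w, top_le T' z w -> top_le S z w) ->
  top_le (top_quot T T') x y -> top_le S y x.
Proof.
move=> hT hT'; rewrite mktopE => /connectP[p]; elim: p x => [|u p IHp] x /=.
  by move=> _ ->; exact: top_refl.
move=> /andP[xu /IHp{}IHp] /IHp uy; apply: top_trans uy _.
by case/orP: xu; [exact: hT|exact: hT'].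
Qed.

Lemma top_quot_mono T T' S S' x y : finer T S -> finer T' S' ->
  top_le (top_quot T T') x y -> top_le (top_quot S S') x y.
Proof.
move=> /finerP TS /finerP TS'; apply: top_quot_least => z w zw.
- exact/top_quot_l/TS.
- exact/top_quot_r/TS'.
Qed.

(** The equivalence relation generated by [T], whose classes are the connected components. Being
    symmetric, it coincides with [top_sim (top_quot T T)], the relation occurring in
    [admissible]. *)
Definition components T : topology X := top_quot T T.

Lemma components_sym T x y :
  top_le (components T) x y -> top_le (components T) y x.
Proof.
rewrite !mktopE sym_connect_sym // => a b /=.
by rewrite orbC.
Qed.

Lemma subspaceE T (Y : {set X}) (a b : subfin Y) :
  top_le (subspace T Y) a b = top_le T (val a) (val b).
Proof. exact: mktopE. Qed.

(** The points of [Y] in the component of [x] form an open set with open complement in [Y], hence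
    all of [Y]. *)
Lemma connected_components T (Y : {set X}) x y :
  connected (subspace T Y) -> x \in Y -> y \in Y -> top_le (components T) x y.
Proof.
move=> /forallP cY xY yY.
pose U := [set z : subfin Y | top_le (components T) x (val z)].
have /implyP := cY U.
have openU : open (subspace T Y) U.
  apply/openP => a b; rewrite !inE subspaceE => xa ab.
  exact: top_trans xa (top_quot_l _ ab).
have openCU : open (subspace T Y) (~: U).
  apply/openP => a b; rewrite !inE subspaceE => xa ab; apply: contra xa => xb.
  exact: top_trans xb (top_quot_r _ ab).
move=> /(_ (introT andP (conj openU openCU))) /orP[] /eqP/setP U_.
  by have := U_ (in_subfin xY); rewrite !inE top_refl.
by have := U_ (in_subfin yY); rewrite !inE.
Qed.

(** A chain of comparable points starting in a component stays in it, and a clopen subset of the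
    component cannot be left along such a chain. *)
Lemma component_connected T x :
  connected (subspace T [set y | top_le (components T) x y]).
Proof.
set Y := [set _ | _]; apply/forallP => U; apply/implyP => /andP[/openP oU /openP oCU].
case: (set_0Vmem U) => [->|[a aU]]; first by rewrite eqxx.
apply/orP; right; apply/eqP/setP => b; rewrite inE; apply/idP.
have step (z w : X) (zY : z \in Y) :
    top_le T z w || top_le T w z -> in_subfin zY \in U ->
    exists2 wY : w \in Y, true & in_subfin wY \in U.
  move=> zw zU.
  have wY : w \in Y.
    rewrite inE; apply: (top_trans (y := z)); first by move: (zY); rewrite inE.
    by case/orP: zw => zw; [exact: top_quot_l|exact: top_quot_r].
  exists wY => //; case/orP: zw => zw; first by apply: (oU _ _ zU); rewrite subspaceE.
  apply: contraLR (zU) => wU; rewrite -in_setC.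
  by apply: (oCU (in_subfin wY)); rewrite ?in_setC // subspaceE.
have : top_le (components T) (val a) (val b).
  apply: top_trans (_ : top_le _ x _); last by have := valP b; rewrite inE.
  by apply: components_sym; have := valP a; rewrite inE.
rewrite mktopE => /connectP[p pth def_b].
have : exists2 bY : val b \in Y, true & in_subfin bY \in U.
  have : exists2 aY : val a \in Y, true & in_subfin aY \in U.
    by exists (valP a) => //; have <- : a = in_subfin (valP a) by exact: val_inj.
  elim: p (val a) pth def_b {aU} => [|w p IHp] z /=; first by move=> _ ->.
  move=> /andP[zw pth] def_b [zY _ zU].
  exact: IHp pth def_b (step _ _ _ zw zU).
by move=> [bY _]; have -> : in_subfin bY = b by exact: val_inj.
Qed.

(** Since [T'] lies in [T], reversed [T']-steps stay inside components of [T], so the quotient joins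
    no two of them. *)
Lemma components_quot T T' x y : finer T' T ->
  top_le (components (top_quot T T')) x y = top_le (components T) x y.
Proof.
move=> fT; apply/idP/idP; last first.
  by apply: top_quot_mono; apply/finerP => ? ?; exact: top_quot_l.
have sub z w : top_le (top_quot T T') z w -> top_le (components T) z w.
  by apply: top_quot_mono => //; apply/finerP.
by apply: top_quot_least => z w /sub // /components_sym.
Qed.

(** The components of [T'] are connected and every connected subset lies in one of them, so the
    restriction condition need only be checked there. In the last condition one implication is
    monotonicity of the quotient. *)
Lemma admissibleP T' T :
  reflect [/\ finer T' T,
     forall x y, top_le T x y -> top_le (components T') x y -> top_le T' x y &
     forall x y, top_le (top_quot T T') x y -> top_le (top_quot T T') y x ->
       top_le (components T') x y]
  (admissible T' T).
Proof.
apply: (iffP and3P) => -[fT' h1 h2]; split=> //.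
- move=> x y xy cxy.
  have /forallP/(_ [set y | top_le (components T') x y]) := h1.
  rewrite component_connected => /eqP e.
  have xY : x \in [set y | top_le (components T') x y] by rewrite inE top_refl.
  have yY : y \in [set y | top_le (components T') x y] by rewrite inE.
  have : top_le (subspace T _) (in_subfin xY) (in_subfin yY) by rewrite subspaceE.
  by rewrite -e subspaceE.
- move=> x y xy yx; move/forallP/(_ x)/forallP/(_ y)/eqP: h2.
  by rewrite /top_sim xy yx => /esym/andP[].
- apply/forallP => Y; apply/implyP => cY; apply/eqP/topologyP => x y.
  rewrite !subspaceE; apply/idP/idP; first exact: (finerP _ _ fT').
  move=> xy; apply: (h1 _ _ xy); apply: (connected_components cY); exact: valP.
- apply/forallP => x; apply/forallP => y; apply/eqP; apply/idP/idP.
    move=> /andP[xy yx]; rewrite /top_sim -/(components T').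
    by rewrite (h2 _ _ xy yx) (h2 _ _ yx xy).
  have fT : finer T' T' by apply/finerP.
  by move=> /andP[xy yx]; apply/andP; split; apply: top_quot_mono fT' fT _.
Qed.

(** A cycle of [T/T''] is a cycle of [T/T'], so its [T]-steps stay in components of [T'] and are
    [T']-steps. It is therefore a cycle of [T'/T''], hence lies in a component of [T'']. *)
Lemma admissible_trans T T' T'' :
  admissible T'' T' -> admissible T' T -> admissible T'' T.
Proof.
move=> /admissibleP[/finerP f2 r2 s2] /admissibleP[/finerP f1 r1 s1].
have c21 x y : top_le (components T'') x y -> top_le (components T') x y.
  by apply: top_quot_mono; apply/finerP.
have q21 x y : top_le (top_quot T T'') x y -> top_le (top_quot T T') x y.
  by apply: top_quot_mono; apply/finerP.
apply/admissibleP; split.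
- by apply/finerP => x y /f2/f1.
- by move=> x y xy cxy; apply: r2 => //; apply: r1 => //; exact: c21.
- have half x y : top_le (top_quot T T'') x y -> top_le (top_quot T T'') y x ->
      top_le (top_quot T' T'') x y.
    move=> xy yx; apply: top_quot_between xy => z w xz wy /orP[zw|wz].
      apply/top_quot_l/(r1 _ _ zw)/s1; first exact: top_quot_l.
      exact: q21 (top_trans wy (top_trans yx xz)).
    exact: top_quot_r.
  by move=> x y xy yx; apply: s2; apply: half.
Qed.

Lemma admissible_quot T T' T'' : admissible T'' T' -> admissible T' T ->
  admissible (top_quot T' T'') (top_quot T T'').
Proof.
move=> a2 a1; have /admissibleP[f2 r2 s2] := a2; have /admissibleP[f1 r1 s1] := a1.
have f0 : finer T'' T'' by apply/finerP.
have ft : finer T T by apply/finerP.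
apply/admissibleP; split.
- by apply/finerP => x y; apply: top_quot_mono.
- move=> x y xy; rewrite (components_quot _ _ f2) => cxy.
  (* The component of [T'] gives a way back from [y] to [x], closing the chain into a cycle of
     [T/T']; its [T]-steps are then [T']-steps. *)
  have yx : top_le (top_quot T T') y x.
    by move/components_sym: cxy; apply: top_quot_mono => //; apply/finerP.
  apply: top_quot_between xy => z w xz wy /orP[zw|wz]; last exact: top_quot_r.
  have mono := top_quot_mono ft f2.
  apply/top_quot_l/(r1 _ _ zw)/s1; first exact: top_quot_l.
  exact: top_trans (mono _ _ wy) (top_trans yx (mono _ _ xz)).
- have sub x y : top_le (top_quot (top_quot T T'') (top_quot T' T'')) x y ->
      top_le (top_quot T T') x y.
    apply: top_quot_least => z w; first exact: top_quot_mono.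
    apply: top_quot_least_rev => u v uv; first exact: top_quot_r.
    exact/top_quot_l/(finerP _ _ f1)/(finerP _ _ f2).
  by move=> x y /sub xy /sub yx; rewrite components_quot //; apply: s1.
Qed.

(** Reversing [T'/T''] yields reversed [T']-steps and [T'']-steps, and the latter already lie in
    [T]. *)
Lemma top_quot_quot T T' T'' : admissible T'' T' -> admissible T' T ->
  top_quot (top_quot T T'') (top_quot T' T'') = top_quot T T'.
Proof.
move=> /admissibleP[f2 _ _] /admissibleP[f1 _ _].
have ft : finer T T by apply/finerP.
apply: topologyP => x y; apply/idP/idP.
  apply: top_quot_least => z w; first exact: top_quot_mono.
  apply: top_quot_least_rev => u v uv; first exact: top_quot_r.
  exact/top_quot_l/(finerP _ _ f1)/(finerP _ _ f2).
apply: top_quot_mono; apply/finerP => z w; exact: top_quot_l.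
Qed.

(* The inverse of [T' |-> top_quot T' T''], see [cut_quot] and [cut_admissible]. *)
Section Cut.
Variables T U : topology X.
Let cut_le x y := top_le T x y && top_le (components U) x y.
Fact cut_refl : reflexive cut_le.
Proof. by move=> x; rewrite /cut_le !top_refl. Qed.
Fact cut_trans : transitive cut_le.
Proof.
move=> y x z /andP[xy cxy] /andP[yz cyz].
by rewrite /cut_le (top_trans xy yz) (top_trans cxy cyz).
Qed.
Definition top_cut : topology X := mktop cut_refl cut_trans.

Lemma top_cutE x y :
  top_le top_cut x y = top_le T x y && top_le (components U) x y.
Proof. exact: mktopE. Qed.
End Cut.

Section CutAdmissible.
Variables T T'' U : topology X.
Hypotheses (aT : admissible T'' T) (aU : admissible U (top_quot T T'')).
Notation T' := (top_cut T U).

(** [T/T''] is contained in [(T/T'')/U], whose cycles stay in components of [U]. *)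
Lemma admissible_sim x y :
  top_le (top_quot T T'') x y -> top_le (top_quot T T'') y x ->
  top_le (components U) x y.
Proof.
have /admissibleP[_ _ s] := aU.
by move=> xy yx; apply: s; apply: top_quot_l.
Qed.

(** Points related by [T''] are equivalent in [T/T'']: one direction comes from [T], the other from
    the reversed [T'']. *)
Lemma finer_cut : finer T'' T'.
Proof.
have /admissibleP[/finerP f _ _] := aT.
apply/finerP => x y xy; rewrite top_cutE (f _ _ xy) /=.
by apply: admissible_sim; [exact/top_quot_l/f|exact: top_quot_r].
Qed.

Lemma cut_finer : finer T' U.
Proof.
have /admissibleP[_ r _] := aU.
by apply/finerP => x y; rewrite top_cutE => /andP[xy]; apply: r; exact: top_quot_l.
Qed.

Lemma cut_quot : top_quot T' T'' = U.
Proof.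
have /admissibleP[/finerP f r s] := aU.
apply: topologyP => x y; apply/idP/idP.
  apply: top_quot_least => z w; first exact: (finerP _ _ cut_finer).
  move=> zw; apply: r; first exact: top_quot_r.
  apply: components_sym.
  by have /(finerP _ _ finer_cut) := zw; rewrite top_cutE => /andP[].
(* The reversed [U]-step closes the chain from [x] to [y] into a cycle of [(T/T'')/U], so each of
   its [T]-steps stays in a component of [U] and belongs to the cut. *)
move=> xy; apply: top_quot_between (f _ _ xy) => z w xz wy /orP[zw|]; last first.
  exact: top_quot_r.
apply: top_quot_l; rewrite top_cutE zw; apply: s; first exact/top_quot_l/top_quot_l.
apply: top_trans (top_quot_l _ wy) _.
by apply: top_trans (top_quot_r _ xy) (top_quot_l _ xz).
Qed.

Lemma components_cut x y :
  top_le (components T') x y = top_le (components U) x y.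
Proof. by rewrite -(components_quot _ _ finer_cut) cut_quot. Qed.

Lemma admissible_cut_l : admissible T'' T'.
Proof.
have /admissibleP[_ r s] := aT.
have fT : finer T' T by apply/finerP => x y; rewrite top_cutE => /andP[].
have f0 : finer T'' T'' by apply/finerP.
apply/admissibleP; split; first exact: finer_cut.
- by move=> x y; rewrite top_cutE => /andP[xy _]; apply: r.
- by move=> x y /(top_quot_mono fT f0) xy /(top_quot_mono fT f0) yx; apply: s.
Qed.

Lemma admissible_cut_r : admissible T' T.
Proof.
have /admissibleP[f r s] := aU.
(* As [T'] is contained in [U], cycles of [T/T'] are cycles of [(T/T'')/U]. *)
have sub x y : top_le (top_quot T T') x y ->
    top_le (top_quot (top_quot T T'') U) x y.
  apply: top_quot_mono; first by apply/finerP => ? ?; exact: top_quot_l.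
  exact: cut_finer.
apply/admissibleP; split.
- by apply/finerP => x y; rewrite top_cutE => /andP[].
- by move=> x y xy; rewrite components_cut top_cutE xy.
- by move=> x y /sub xy /sub yx; rewrite components_cut; apply: s.
Qed.
End CutAdmissible.

(** The components of [T'/T''] are those of [T'], and [T'] is the restriction of [T] to them. *)
Lemma cut_admissible T T' T'' : admissible T'' T' -> admissible T' T ->
  top_cut T (top_quot T' T'') = T'.
Proof.
move=> /admissibleP[f2 _ _] /admissibleP[/finerP f1 r1 _].
apply: topologyP => x y; rewrite top_cutE components_quot //.
apply/andP/idP => [[xy /r1]|xy]; first exact.
by split; [exact: f1|exact: top_quot_l].
Qed.
End QuotientTopology.

(** * Compatibility of the cut with the quandle *)

Section Compatible.
Variables (X : finType) (Q : quandle X).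

(** The component relation of [U] is the quotient [U/U], which is compatible, and compatibility
    passes to intersections. *)
Lemma compatible_cut T U :
  compatible Q T -> compatible Q U -> compatible Q (top_cut T U).
Proof.
move=> /compatibleP cT cU; have /compatibleP cC := compatible_quot cU cU.
apply/compatibleP => x x' y y'; rewrite !top_cutE => /andP[xx cx] /andP[yy cy].
by rewrite cT // cC.
Qed.

End Compatible.

(** * Symmetric quasi-orders, the support of the counit *)

Section Symmetric.
Variable X : finType.
Implicit Types T : topology X.

Definition symmetric_top T : bool :=
  [forall x, forall y, top_le T x y ==> top_le T y x].

Lemma symmetric_topP T :
  reflect (forall x y, top_le T x y -> top_le T y x) (symmetric_top T).
Proof.
apply: (iffP forallP) => [h x y|h x]; first by have /forallP/(_ y)/implyP := h x.
by apply/forallP => y; apply/implyP; exact: h.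
Qed.

Section Sim.
Variable T : topology X.
Fact sim_refl : reflexive (top_sim T).
Proof. by move=> x; rewrite /top_sim !top_refl. Qed.
Fact sim_trans : transitive (top_sim T).
Proof.
move=> y x z /andP[xy yx] /andP[yz zy].
by rewrite /top_sim (top_trans xy yz) (top_trans zy yx).
Qed.
Definition sim_top : topology X := mktop sim_refl sim_trans.
Lemma sim_topE x y : top_le sim_top x y = top_le T x y && top_le T y x.
Proof. exact: mktopE. Qed.
End Sim.

Lemma sim_top_symmetric T : symmetric_top (sim_top T).
Proof. by apply/symmetric_topP => x y; rewrite !sim_topE andbC. Qed.

Lemma top_quot_sim T : top_quot T (sim_top T) = T.
Proof.
apply: topologyP => x y; apply/idP/idP; last exact: top_quot_l.
by apply: top_quot_least => // z w; rewrite sim_topE => /andP[].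
Qed.

Lemma admissible_sim_top T : admissible (sim_top T) T.
Proof.
apply/admissibleP; split.
- by apply/finerP => x y; rewrite sim_topE => /andP[].
- move=> x y xy c; rewrite sim_topE xy /=; apply: top_quot_least_rev c => z w;
  by rewrite sim_topE => /andP[].
- by move=> x y; rewrite top_quot_sim => xy yx; apply: top_quot_l; rewrite sim_topE xy.
Qed.

(** A symmetric [T'] is its own component relation, and points equivalent for [T] lie on a cycle of
    [T/T'], hence in one component of [T']. *)
Lemma admissible_symmetric T' T :
  symmetric_top T' -> admissible T' T -> T' = sim_top T.
Proof.
move=> /symmetric_topP sT' /admissibleP[/finerP f _ s].
apply: topologyP => x y; rewrite sim_topE; apply/idP/andP.
  by move=> xy; split; [exact: f|exact/f/sT'].
move=> [xy yx]; have : top_le (components T') x y by apply: s; exact: top_quot_l.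
by apply: top_quot_least => // z w; exact: sT'.
Qed.

Lemma admissible_refl T : admissible T T.
Proof. by apply/admissibleP; split=> //; apply/finerP. Qed.

Lemma components_symmetric T : symmetric_top (components T).
Proof. by apply/symmetric_topP => x y; exact: components_sym. Qed.

(** When [T/T'] is symmetric, each [T]-step lies on a cycle of [T/T'] and so stays in a component of
    [T'], where [T] and [T'] agree. *)
Lemma symmetric_quot T' T :
  symmetric_top (top_quot T T') -> admissible T' T -> T' = T.
Proof.
move=> /symmetric_topP sq /admissibleP[/finerP f r s].
apply: topologyP => x y; apply/idP/idP => [/f //|xy].
by apply: r => //; apply: s; [|apply: sq]; exact: top_quot_l.
Qed.

Lemma compatible_sim (Q : quandle X) T :
  compatible Q T -> compatible Q (sim_top T).
Proof.
move=> /compatibleP c; apply/compatibleP => x x' y y'; rewrite !sim_topE.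
by move=> /andP[xx xx'] /andP[yy yy']; rewrite !c.
Qed.
End Symmetric.

(** * Relabelling along a bijection *)

Section PullTopology.
Variables (X Y : finType) (f : bij X Y).
Implicit Types T : topology Y.

Lemma top_pullE T x y : top_le (top_pull f T) x y = top_le T (f x) (f y).
Proof. exact: mktopE. Qed.

Lemma top_pull_quot T T' :
  top_quot (top_pull f T) (top_pull f T') = top_pull f (top_quot T T').
Proof.
apply: topologyP => x y; apply/idP/idP.
  by apply: top_quot_least => z w; rewrite !top_pullE;
    [exact: top_quot_l|exact: top_quot_r].
have pullE S z w : top_le (top_pull (sym_bij f) S) z w =
    top_le S (bij_inv f z) (bij_inv f w) by exact: mktopE.
(* The conclusion is moved to a topology on [Y], where [top_quot_least] applies. *)
rewrite top_pullE -{2}[x](bij_funK f) -{2}[y](bij_funK f) -pullE.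
apply: top_quot_least => z w zw; rewrite pullE.
  by apply: top_quot_l; rewrite top_pullE !bij_invK.
by apply: top_quot_r; rewrite top_pullE !bij_invK.
Qed.
End PullTopology.

Lemma top_pullK (X Y : finType) (f : bij X Y) T :
  top_pull (sym_bij f) (top_pull f T) = T.
Proof. by apply: topologyP => x y; rewrite !top_pullE /= !bij_invK. Qed.

Lemma top_pullKV (X Y : finType) (f : bij X Y) T :
  top_pull f (top_pull (sym_bij f) T) = T.
Proof. by apply: topologyP => x y; rewrite !top_pullE /= !bij_funK. Qed.

Lemma quandle_pullK (X Y : finType) (f : bij X Y) Q :
  quandle_pull (sym_bij f) (quandle_pull f Q) = Q.
Proof.
apply: quandleP => x y.
by rewrite !mkquandleE /pull_op mkquandleE /pull_op /= !bij_invK.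
Qed.

Lemma compatible_pullE (X Y : finType) (f : bij X Y) Q T :
  compatible (quandle_pull f Q) (top_pull f T) = compatible Q T.
Proof.
apply/idP/idP => [/(compatible_pull (sym_bij f))|]; last exact: compatible_pull.
by rewrite quandle_pullK top_pullK.
Qed.

Lemma admissible_pull (X Y : finType) (f : bij X Y) T' T :
  admissible T' T -> admissible (top_pull f T') (top_pull f T).
Proof.
move=> /admissibleP[/finerP h r s]; apply/admissibleP; rewrite /components.
rewrite !top_pull_quot; split.
- by apply/finerP => x y; rewrite !top_pullE; exact: h.
- by move=> x y; rewrite !top_pullE; exact: r.
- by move=> x y; rewrite !top_pullE; exact: s.
Qed.

Lemma admissible_pullE (X Y : finType) (f : bij X Y) T' T :
  admissible (top_pull f T') (top_pull f T) = admissible T' T.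
Proof.
apply/idP/idP => [/(admissible_pull (sym_bij f))|]; last exact: admissible_pull.
by rewrite !top_pullK.
Qed.

Lemma symmetric_pullE (X Y : finType) (f : bij X Y) T :
  symmetric_top (top_pull f T) = symmetric_top T.
Proof.
apply/symmetric_topP/symmetric_topP => h x y; last by rewrite !top_pullE; exact: h.
by move: (h (bij_inv f x) (bij_inv f y)); rewrite !top_pullE !bij_invK.
Qed.

(** * Disjoint unions *)

Section SumTopology.
Variables X Y : finType.

Section Restrict.
Variable T : topology (X + Y)%type.
Definition top_left : topology X :=
  @mktop X (fun x y => top_le T (inl x) (inl y))
    (fun x => top_refl T (inl x)) (fun y x z => @top_trans _ T (inl y) (inl x) (inl z)).
Definition top_right : topology Y :=
  @mktop Y (fun x y => top_le T (inr x) (inr y))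
    (fun x => top_refl T (inr x)) (fun y x z => @top_trans _ T (inr y) (inr x) (inr z)).
Lemma top_leftE x y : top_le top_left x y = top_le T (inl x) (inl y).
Proof. exact: mktopE. Qed.
Lemma top_rightE x y : top_le top_right x y = top_le T (inr x) (inr y).
Proof. exact: mktopE. Qed.
End Restrict.

Implicit Types (T : topology X) (S : topology Y).

Lemma top_sumE T S a b : top_le (top_sum T S) a b = sum_le T S a b.
Proof. exact: mktopE. Qed.

Lemma top_left_sum T S : top_left (top_sum T S) = T.
Proof. by apply: topologyP => x y; rewrite top_leftE top_sumE. Qed.

Lemma top_right_sum T S : top_right (top_sum T S) = S.
Proof. by apply: topologyP => x y; rewrite top_rightE top_sumE. Qed.

(** A topology finer than a disjoint union never compares points of different summands, so its two
    restrictions determine it. *)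
Lemma top_sum_restrict T S U : finer U (top_sum T S) ->
  top_sum (top_left U) (top_right U) = U.
Proof.
move=> /finerP f; apply: topologyP => -[x|x] [y|y];
  rewrite top_sumE /= ?top_leftE ?top_rightE //;
  by apply/esym/negP => /f; rewrite top_sumE.
Qed.

Lemma top_sum_quot T T' S S' :
  top_quot (top_sum T S) (top_sum T' S') =
  top_sum (top_quot T T') (top_quot S S').
Proof.
apply: topologyP => a b; apply/idP/idP.
  apply: top_quot_least => -[x|x] [y|y]; rewrite !top_sumE //=;
    [exact: top_quot_l|exact: top_quot_l|exact: top_quot_r|exact: top_quot_r].
rewrite top_sumE; case: a b => x [y|y] //=.
- rewrite -top_leftE; apply: top_quot_least => z w zw; rewrite top_leftE.
    by apply: top_quot_l; rewrite top_sumE.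
  by apply: top_quot_r; rewrite top_sumE.
- rewrite -top_rightE; apply: top_quot_least => z w zw; rewrite top_rightE.
    by apply: top_quot_l; rewrite top_sumE.
  by apply: top_quot_r; rewrite top_sumE.
Qed.

Lemma admissible_sumE T T' S S' :
  admissible (top_sum T' S') (top_sum T S) = admissible T' T && admissible S' S.
Proof.
apply/admissibleP/andP.
  rewrite /components !top_sum_quot => -[/finerP f r s]; split;
    apply/admissibleP; split.
  - by apply/finerP => x y; move: (f (inl x) (inl y)); rewrite !top_sumE.
  - by move=> x y; move: (r (inl x) (inl y)); rewrite !top_sumE.
  - by move=> x y; move: (s (inl x) (inl y)); rewrite !top_sumE.
  - by apply/finerP => x y; move: (f (inr x) (inr y)); rewrite !top_sumE.
  - by move=> x y; move: (r (inr x) (inr y)); rewrite !top_sumE.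
  - by move=> x y; move: (s (inr x) (inr y)); rewrite !top_sumE.
move=> [/admissibleP[/finerP f r s] /admissibleP[/finerP f' r' s']].
rewrite /components !top_sum_quot; split; first apply/finerP;
  move=> [x|x] [y|y]; rewrite !top_sumE //=.
- exact: f.
- exact: f'.
- exact: r.
- exact: r'.
- exact: s.
- exact: s'.
Qed.

Lemma compatible_sumE Q R T S :
  compatible (quandle_sum Q R) (top_sum T S) = compatible Q T && compatible R S.
Proof.
apply/idP/andP => [/compatibleP c|[]]; last exact: compatible_sum.
split; apply/compatibleP => x x' y y'.
- by move: (c (inl x) (inl x') (inl y) (inl y')); rewrite !mkquandleE !top_sumE.
- by move: (c (inr x) (inr x') (inr y) (inr y')); rewrite !mkquandleE !top_sumE.
Qed.

Lemma symmetric_sumE T S :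
  symmetric_top (top_sum T S) = symmetric_top T && symmetric_top S.
Proof.
apply/symmetric_topP/andP => [h|[/symmetric_topP h /symmetric_topP h']].
  split; apply/symmetric_topP => x y.
  - by move: (h (inl x) (inl y)); rewrite !top_sumE.
  - by move: (h (inr x) (inr y)); rewrite !top_sumE.
by move=> [x|x] [y|y]; rewrite !top_sumE //=; [exact: h|exact: h'].
Qed.
End SumTopology.

(** * Linear maps determined on a spanning set *)

Section Spanning.
Variable k : fieldType.

Lemma tens_suml (V W : lmodType k) (I : finType) (P : pred I) (F : I -> V) (w : W) :
  (\sum_(i | P i) F i) ⊗ w = \sum_(i | P i) F i ⊗ w :> (V ⊗ W)%type.
Proof. exact: linear_sumlz. Qed.

Lemma tens_sumr (V W : lmodType k) (I : finType) (P : pred I) (F : I -> W) (v : V) :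
  v ⊗ (\sum_(i | P i) F i) = \sum_(i | P i) v ⊗ F i :> (V ⊗ W)%type.
Proof. exact: linear_sumr. Qed.

(** Encoded as an induction principle, so that it can be used directly with [elim/]. *)
Definition spans (V : lmodType k) (B : V -> Prop) : Prop :=
  forall P : V -> Prop, P 0 -> (forall a u v, P u -> P v -> P (a *: u + v)) ->
  (forall v, B v -> P v) -> forall v, P v.

Lemma spans_lin_eq (V W : lmodType k) (B : V -> Prop) (f g : {linear V -> W}) :
  spans B -> (forall v, B v -> f v = g v) -> f =1 g.
Proof.
move=> spB fg; apply: spB => [|a u v fu fv|//]; first by rewrite !linear0.
by rewrite !linearP fu fv.
Qed.

Definition pure_tensors (V W : lmodType k) (B : V -> Prop) (C : W -> Prop)
    (t : (V ⊗ W)%type) : Prop :=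
  exists v w, [/\ B v, C w & t = v ⊗ w].

Lemma spans_tens (V W : lmodType k) (B : V -> Prop) (C : W -> Prop) :
  spans B -> spans C -> spans (pure_tensors B C).
Proof.
move=> spB spC P P0 PD PS; elim/tensor_ind => [//|s t Ps Pt|v w].
  by rewrite -[s]scale1r; exact: PD.
elim/spB: v => [|a u v Pu Pv|v Bv].
- by rewrite linear0l.
- by rewrite tensDl tensZl; exact: PD.
elim/spC: w => [|a u w Pu Pw|w Cw].
- by rewrite linear0r.
- by rewrite tensDr tensZr; exact: PD.
by apply: PS; exists v, w.
Qed.
End Spanning.

(** * The basis of topological quandles and the operations on it *)

Section Structures.
Variable k : fieldType.

(* Indexing basis vectors by a plain pair avoids the dependent sums of [QT_coprod];
   the value is 0 when [T] is not [Q]-compatible. *)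
Definition structure (X : finType) (Q : quandle X) (T : topology X) : QT k X :=
  [ffun s : top_quandle X => (tq_pair s == (Q, T))%:R].

Lemma structureE (X : finType) (Q : quandle X) (T : topology X)
    (c : compatible Q T) :
  structure Q T = tq_vect k (@TopQuandle X (Q, T) c).
Proof.
apply/ffunP => s; rewrite !ffunE; congr (_ %:R); exact: esym (val_eqE s _).
Qed.

Lemma tq_vectE (X : finType) (s : top_quandle X) :
  tq_vect k s = structure (tq_quandle s) (tq_top s).
Proof. by case: s => -[Q T] c; rewrite -structureE. Qed.

Definition structures (X : finType) (x : QT k X) : Prop :=
  exists Q T, compatible Q T /\ x = structure Q T.

Lemma QT_spans (X : finType) : spans (@structures X).
Proof.
move=> P P0 PD PS x; rewrite (free_basisE x).
elim/big_ind: _ => // [u v Pu Pv|s _]; first by rewrite -[u]scale1r; exact: PD.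
rewrite -[_ *: _]addr0; apply: (PD _ _ 0 _ P0); apply: PS.
exists (tq_quandle s), (tq_top s); split; first exact: (valP s).
by rewrite -tq_vectE.
Qed.

Lemma QT_lin_eq (X : finType) (V : lmodType k) (f g : {linear QT k X -> V}) :
  (forall Q T, compatible Q T -> f (structure Q T) = g (structure Q T)) ->
  f =1 g.
Proof.
by move=> fg; apply: (spans_lin_eq (@QT_spans X)) => _ [Q [T [c ->]]]; exact: fg.
Qed.

Lemma QT_tensor_lin_eq (X Y : finType) (V : lmodType k)
    (f g : {linear (QT k X ⊗ QT k Y)%type -> V}) :
  (forall Q T R S, compatible Q T -> compatible R S ->
     f (structure Q T ⊗ structure R S) = g (structure Q T ⊗ structure R S)) ->
  f =1 g.
Proof.
move=> fg; apply: (spans_lin_eq (spans_tens (@QT_spans X) (@QT_spans Y))).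
by move=> _ [_ [_ [[Q [T [c ->]]] [R [S [d ->]]] ->]]]; exact: fg.
Qed.

Lemma QT_tensor3_lin_eq (X Y Z : finType) (V : lmodType k)
    (f g : {linear ((QT k X ⊗ QT k Y) ⊗ QT k Z)%type -> V}) :
  (forall Q T R S O U, compatible Q T -> compatible R S -> compatible O U ->
     f ((structure Q T ⊗ structure R S) ⊗ structure O U) =
     g ((structure Q T ⊗ structure R S) ⊗ structure O U)) ->
  f =1 g.
Proof.
move=> fg; apply: (spans_lin_eq
  (spans_tens (spans_tens (@QT_spans X) (@QT_spans Y)) (@QT_spans Z))).
move=> _ [_ [_ [[_ [_ [[Q [T [c ->]]] [R [S [d ->]]] ->]]] [O [U [e ->]]] ->]]].
exact: fg.
Qed.

Lemma QT_map_vect (X Y : finType) (f : bij X Y) (s : top_quandle Y) :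
  sp_map (QT k) f (tq_vect k s) = tq_vect k (tq_pull f s).
Proof. exact: free_liftE. Qed.

Lemma QT_map_structure (X Y : finType) (f : bij X Y) Q T : compatible Q T ->
  sp_map (QT k) f (structure Q T) = structure (quandle_pull f Q) (top_pull f T).
Proof. by move=> c; rewrite structureE QT_map_vect tq_vectE. Qed.

Lemma product_structure (X Y : finType) Q R T S :
  compatible Q T -> compatible R S ->
  product (@QT_mul k) X Y (structure Q T ⊗ structure R S) =
  structure (quandle_sum Q R) (top_sum T S).
Proof. by move=> c d; rewrite (structureE c) (structureE d) QT_mulE tq_vectE. Qed.

(** With the sum running over all topologies subject to a predicate, double sums can be exchanged
    and reindexed. *)
Lemma coprod_structure (X : finType) (Q : quandle X) T : compatible Q T ->
  QT_coprod k X (structure Q T) =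
  \sum_(T' : topology X | compatible Q T' && admissible T' T)
     structure Q T' ⊗ structure Q (top_quot T T').
Proof.
move=> c; rewrite (structureE c) QT_coprodE /=.
rewrite [RHS](reindex_omap (@ct_top X Q) insub) => [|T' /andP[cT' _]]; last first.
  by rewrite insubT.
apply: eq_big => [T'|T' _]; last by rewrite !tq_vectE.
by rewrite valP valK eqxx andbT.
Qed.

Definition QT_counit (X : finType) : {linear QT k X -> hadamard_unit k X} :=
  free_lift (fun s => (symmetric_top (tq_top s))%:R : k^o).

Lemma counit_structure (X : finType) (Q : quandle X) T : compatible Q T ->
  QT_counit X (structure Q T) = (symmetric_top T)%:R :> k.
Proof. by move=> c; rewrite (structureE c) [LHS]free_liftE. Qed.
End Structures.

(** * The bialgebra axioms *)

Section Bialgebra.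
Variable k : fieldType.
Notation m := (@QT_mul k).
Notation Gamma := (@QT_coprod k).
Notation eps := (@QT_counit k).

(** Pullback along [f] is a bijection between topologies that preserves compatibility, admissibility
    and quotients. *)
Lemma coprod_species_morphism : species_morphism Gamma.
Proof.
move=> X Y f; elim/QT_spans => [|a x y Px Py|_ [Q [T [c ->]]]].
- by rewrite !linear0.
- by rewrite !linearP Px Py.
rewrite QT_map_structure // !coprod_structure ?compatible_pullE //.
rewrite linear_sum (reindex_onto (top_pull f) (top_pull (sym_bij f))) /=.
  apply: eq_big => [T'|T' /andP[/andP[cT' _] _]].
    by rewrite top_pullK eqxx andbT compatible_pullE admissible_pullE.
  rewrite compatible_pullE in cT'.
  rewrite top_pull_quot -!QT_map_structure ?compatible_quot //.
  by apply/esym; exact: tmapE.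
by move=> T' _; rewrite top_pullKV.
Qed.

Lemma counit_species_morphism : species_morphism eps.
Proof.
move=> X Y f; elim/QT_spans => [|a x y Px Py|_ [Q [T [c ->]]]].
- by rewrite !linear0.
- by rewrite !linearP Px Py.
rewrite QT_map_structure // [LHS]counit_structure ?compatible_pullE //.
by rewrite [RHS]counit_structure // symmetric_pullE.
Qed.

Lemma coprod_coassoc (X : finType) (x : QT k X) :
  tassoc _ _ _ (tmap (Gamma X) idfun (Gamma X x)) =
  tmap idfun (Gamma X) (Gamma X x).
Proof.
(* Both sides are packaged as linear maps, to be compared on structures; [change] then restores the
   applied form. *)
pose l : {linear _ -> _} := tassoc _ _ _ \o (tmap (Gamma X) idfun \o Gamma X).
pose r : {linear _ -> _} := tmap idfun (Gamma X) \o Gamma X.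
apply: (QT_lin_eq (f := l) (g := r)) => Q T c.
change (tassoc _ _ _ (tmap (Gamma X) idfun (Gamma X (structure k Q T)))
  = tmap idfun (Gamma X) (Gamma X (structure k Q T))).
rewrite coprod_structure // (linear_sum (tmap (Gamma X) idfun)).
rewrite (linear_sum (tassoc _ _ _)) (linear_sum (tmap idfun (Gamma X))).
(* The left side is a sum over chains of [T''] admissible in [T'] admissible in [T], with [T']
   outermost. *)
transitivity (\sum_(T' : topology X | compatible Q T' && admissible T' T)
  \sum_(T'' : topology X | compatible Q T'' && admissible T'' T')
    structure k Q T'' ⊗
      (structure k Q (top_quot T' T'') ⊗ structure k Q (top_quot T T'))).
  apply: eq_bigr => T' /andP[cT' aT'].
  rewrite tmapE coprod_structure // /hadamard_obj tens_suml (linear_sum (tassoc _ _ _)).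
  by apply: eq_bigr => T'' _; exact: tassocE.
(* [admissible_trans] provides the range of [T''] once it becomes the outer index. *)
rewrite (exchange_big_dep (fun T'' => compatible Q T'' && admissible T'' T)) /=.
  apply: eq_bigr => T'' /andP[cT'' aT''].
  rewrite tmapE coprod_structure ?compatible_quot // tens_sumr.
  (* The right side runs over [U] admissible in [T/T'']; substituting [U = T'/T''] makes it a sum
     over the intermediate [T']. *)
  rewrite [RHS](reindex_onto (fun T' => top_quot T' T'') (top_cut T)); last first.
    by move=> U /andP[_]; exact: cut_quot.
  apply: eq_big => [T'|T'].
    apply/andP/andP => [[/andP[cT' aT'] /andP[_ b]]|].
      rewrite (compatible_quot cT' cT'') (admissible_quot b aT').
      by rewrite (cut_admissible b aT').
    move=> [/andP[cU aU] /eqP <-].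
    rewrite (compatible_cut c cU) cT'' (admissible_cut_l aT'' aU).
    by rewrite (admissible_cut_r aT'' aU).
  by move=> /andP[/andP[_ aT'] /andP[_ a]]; rewrite (top_quot_quot a aT').
move=> T' T'' /andP[_ a] /andP[-> b] /=; exact: admissible_trans b a.
Qed.

Lemma coprod_counitl (X : finType) (x : QT k X) :
  tunitl _ (tmap (eps X) idfun (Gamma X x)) = x.
Proof.
pose l : {linear _ -> _} := tunitl _ \o (tmap (eps X) idfun \o Gamma X).
pose r : {linear QT k X -> QT k X} := idfun.
apply: (QT_lin_eq (f := l) (g := r)) => Q T c.
change (tunitl _ (tmap (eps X) idfun (Gamma X (structure k Q T))) = structure k Q T).
have E T' v : compatible Q T' ->
    tunitl _ (tmap (eps X) idfun (structure k Q T' ⊗ v)) =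
    (symmetric_top T')%:R *: v.
  move=> cT'; rewrite tmapE; rewrite [LHS]tunitlE; congr (_ *: _).
  exact: counit_structure.
rewrite coprod_structure // (linear_sum (tmap (eps X) idfun)).
rewrite (linear_sum (tunitl _)).
(* This is the only term with a symmetric left factor, and its right factor is [T]. *)
rewrite (bigD1 (sim_top T)); last by rewrite compatible_sim // admissible_sim_top.
rewrite big1 => [|T' /andP[/andP[cT' aT'] nT']].
  rewrite [LHS]addr0 [LHS]E ?compatible_sim //.
  by rewrite sim_top_symmetric scale1r top_quot_sim.
have /negPf ns : ~~ symmetric_top T'.
  by apply: contra nT' => s; apply/eqP/admissible_symmetric.
by rewrite [LHS]E // ns scale0r.
Qed.

Lemma coprod_counitr (X : finType) (x : QT k X) :
  tunitr _ (tmap idfun (eps X) (Gamma X x)) = x.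
Proof.
pose l : {linear _ -> _} := tunitr _ \o (tmap idfun (eps X) \o Gamma X).
pose r : {linear QT k X -> QT k X} := idfun.
apply: (QT_lin_eq (f := l) (g := r)) => Q T c.
change (tunitr _ (tmap idfun (eps X) (Gamma X (structure k Q T))) = structure k Q T).
have E T' v : compatible Q T' ->
    tunitr _ (tmap idfun (eps X) (v ⊗ structure k Q T')) =
    (symmetric_top T')%:R *: v.
  move=> cT'; rewrite tmapE; rewrite [LHS]tunitrE; congr (_ *: _).
  exact: counit_structure.
rewrite coprod_structure // (linear_sum (tmap idfun (eps X))).
rewrite (linear_sum (tunitr _)).
(* At [T' = T] the right factor is [components T], which is symmetric; no other term has a symmetric
   quotient. *)
rewrite (bigD1 T); last by rewrite c admissible_refl.
rewrite big1 => [|T' /andP[/andP[cT' aT'] nT']].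
  rewrite [LHS]addr0 [LHS]E ?compatible_quot //.
  by rewrite components_symmetric scale1r.
have /negPf ns : ~~ symmetric_top (top_quot T T').
  by apply: contra nT' => s; apply/eqP/symmetric_quot.
by rewrite [LHS]E ?compatible_quot // ns scale0r.
Qed.

Lemma coprod_product (X Y : finType) (x : QT k X) (y : QT k Y) :
  Gamma (X + Y)%type (product m X Y (x ⊗ y)) =
  tmap (product m X Y) (product m X Y)
      (tau23 _ _ _ _ (Gamma X x ⊗ Gamma Y y)).
Proof.
pose r : {linear _ -> _} := tmap (product m X Y) (product m X Y) \o
  (tau23 _ _ _ _ \o tmap (Gamma X) (Gamma Y)).
pose l : {linear _ -> _} := Gamma (X + Y)%type \o product m X Y.
suff e : l =1 r by rewrite [LHS](e (x ⊗ y)) /r /= tmapE.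
apply: QT_tensor_lin_eq => Q T R S c d.
change (Gamma (X + Y)%type (product m X Y (structure k Q T ⊗ structure k R S)) =
  tmap (product m X Y) (product m X Y) (tau23 _ _ _ _
    (tmap (Gamma X) (Gamma Y) (structure k Q T ⊗ structure k R S)))).
rewrite product_structure // tmapE !coprod_structure ?compatible_sum //.
transitivity (\sum_(T' : topology X | compatible Q T' && admissible T' T)
  \sum_(S' : topology Y | compatible R S' && admissible S' S)
    structure k (quandle_sum Q R) (top_sum T' S') ⊗
    structure k (quandle_sum Q R) (top_sum (top_quot T T') (top_quot S S'))).
  (* A topology admissible in a disjoint union splits into its restrictions to [X] and [Y], so the
     single sum becomes a sum over pairs. *)
  rewrite pair_big (reindex_onto (fun p => top_sum p.1 p.2)
    (fun U => (top_left U, top_right U))) => [|U /andP[_ aU]]; last first.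
    by apply: (top_sum_restrict (T := T) (S := S)); have /admissibleP[] := aU.
  apply: eq_big => [[T' S']|[T' S'] _]; last by rewrite /= top_sum_quot.
  rewrite /= compatible_sumE admissible_sumE top_left_sum top_right_sum eqxx andbT.
  by rewrite andbACA.
rewrite /hadamard_obj tens_suml (linear_sum (tau23 _ _ _ _)).
rewrite (linear_sum (tmap (product m X Y) (product m X Y))).
apply: eq_bigr => T' /andP[cT' aT'].
rewrite tens_sumr (linear_sum (tau23 _ _ _ _)).
rewrite (linear_sum (tmap (product m X Y) (product m X Y))).
apply: eq_bigr => S' /andP[cS' aS'].
rewrite -(product_structure k cT' cS').
rewrite -(product_structure k (compatible_quot c cT') (compatible_quot d cS')).
by rewrite [in RHS]tau23E; apply/esym; exact: tmapE.
Qed.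

Lemma QT_product_assoc (X Y Z : finType) (x : QT k X) (y : QT k Y) (z : QT k Z) :
  product m (X + Y)%type Z (product m X Y (x ⊗ y) ⊗ z) =
  sp_map (QT k) (sumA_bij X Y Z)
    (product m X (Y + Z)%type (x ⊗ product m Y Z (y ⊗ z))).
Proof.
pose l : {linear _ -> _} :=
  product m (X + Y)%type Z \o tmap (product m X Y) idfun.
pose r : {linear _ -> _} := sp_map (QT k) (sumA_bij X Y Z) \o
  (product m X (Y + Z)%type \o (tmap idfun (product m Y Z) \o tassoc _ _ _)).
have lE u w : l (u ⊗ w) = product m (X + Y)%type Z (product m X Y u ⊗ w).
  by rewrite /l /= tmapE.
have rE u v w : r ((u ⊗ v) ⊗ w) = sp_map (QT k) (sumA_bij X Y Z)
    (product m X (Y + Z)%type (u ⊗ product m Y Z (v ⊗ w))).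
  by rewrite /r [in LHS]/= tassocE tmapE.
rewrite -lE -rE; apply: QT_tensor3_lin_eq => Q T R S O U c d e.
rewrite lE rE !product_structure ?compatible_sum //.
rewrite QT_map_structure; last by rewrite !compatible_sum.
apply: (congr2 (@structure k _)).
- apply: quandleP => -[[a|a]|a] [[b|b]|b];
  by rewrite !mkquandleE /pull_op ?mkquandleE /= ?mkquandleE /= ?mkquandleE.
- apply: topologyP => -[[a|a]|a] [[b|b]|b];
  by rewrite top_pullE !top_sumE /= ?top_sumE.
Qed.

Fact void_op_idem (a : void) : (fun a _ : void => a) a a = a.
Proof. by []. Qed.
Fact void_op_inj (b : void) : injective ((fun a _ : void => a)^~ b).
Proof. by case. Qed.
Fact void_op_dist (a b c : void) : let op := fun a _ : void => a in
  op (op a b) c = op (op a c) (op b c).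
Proof. by []. Qed.
Definition void_quandle : quandle void :=
  mkquandle void_op_idem void_op_inj void_op_dist.
Definition void_top : topology void :=
  @mktop void (fun _ _ => true) (fun _ => erefl) (fun _ _ _ _ _ => erefl).

Lemma void_topE (T : topology void) : T = void_top.
Proof. by apply: topologyP => -[]. Qed.

Lemma compatible_void T : compatible void_quandle T.
Proof. by apply/compatibleP => -[]. Qed.

Definition QT_unit : QT k void := structure k void_quandle void_top.

Lemma coprod_unit : Gamma void QT_unit = QT_unit ⊗ QT_unit.
Proof.
rewrite coprod_structure ?compatible_void // (bigD1 void_top) /=; last first.
  by rewrite compatible_void admissible_refl.
(* [void] carries a single topology, so there is no other term. *)
rewrite big1 => [|T' /andP[_ /eqP[]]]; last exact: void_topE.
by rewrite [LHS]addr0 (void_topE (top_quot _ _)).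
Qed.

Lemma counit_unit1 : eps void QT_unit = 1 :> k.
Proof.
rewrite counit_structure ?compatible_void //.
by have -> : symmetric_top void_top by apply/symmetric_topP => -[].
Qed.

Lemma QT_product_unitl (X : finType) (x : QT k X) :
  product m void X (QT_unit ⊗ x) = sp_map (QT k) (sum0l_bij X) x.
Proof.
elim/QT_spans: x => [|a x y Px Py|_ [Q [T [c ->]]]].
- by rewrite linear0r !linear0.
- by rewrite tensDr tensZr (linearP (product m void X)) linearP Px Py.
rewrite product_structure ?compatible_void // QT_map_structure //.
apply: (congr2 (@structure k _)).
- by apply: quandleP => -[[]|a] [[]|b]; rewrite !mkquandleE.
- by apply: topologyP => -[[]|a] [[]|b]; rewrite top_pullE top_sumE.
Qed.

Lemma QT_product_unitr (X : finType) (x : QT k X) :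
  product m X void (x ⊗ QT_unit) = sp_map (QT k) (sum0r_bij X) x.
Proof.
elim/QT_spans: x => [|a x y Px Py|_ [Q [T [c ->]]]].
- by rewrite linear0l !linear0.
- by rewrite tensDl tensZl (linearP (product m X void)) linearP Px Py.
rewrite product_structure ?compatible_void // QT_map_structure //.
apply: (congr2 (@structure k _)).
- by apply: quandleP => -[a|[]] [b|[]]; rewrite !mkquandleE.
- by apply: topologyP => -[a|[]] [b|[]]; rewrite top_pullE top_sumE.
Qed.

Lemma QT_counit_product (X Y : finType) (x : QT k X) (y : QT k Y) :
  eps (X + Y)%type (product m X Y (x ⊗ y)) = eps X x * eps Y y :> k.
Proof.
pose l : {linear _ -> _} := eps (X + Y)%type \o product m X Y.
(* The product of scalars is written as a linear map on the tensor product, so that both sides can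
   be compared on pairs of structures. *)
pose r : {linear _ -> _} := tunitl k^o \o tmap (eps X) (eps Y).
have rE u v : r (u ⊗ v) = eps X u * eps Y v.
  by rewrite /r [LHS]/= tmapE; exact: tunitlE.
rewrite -rE; apply: (QT_tensor_lin_eq (f := l)) => Q T R S c d.
rewrite rE (counit_structure k c) (counit_structure k d).
change (eps (X + Y)%type (product m X Y (structure k Q T ⊗ structure k R S)) =
  (symmetric_top T)%:R * (symmetric_top S)%:R :> k).
rewrite product_structure // counit_structure ?compatible_sum //.
by rewrite symmetric_sumE -mulnb natrM.
Qed.

Lemma QT_product_commutative : product_commutative m.
Proof.
(* Linearity is used in one factor at a time: here the left one, with a structure on the right. *)
move=> X Y; have half x S R : compatible R S ->
    product m X Y (x ⊗ structure k R S) =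
    sp_map (QT k) (sumC_bij X Y) (product m Y X (structure k R S ⊗ x)).
  move=> d; elim/QT_spans: x => [|a x y Px Py|_ [Q [T [c ->]]]].
  - by rewrite linear0l linear0r !linear0.
  - rewrite tensDl tensZl tensDr tensZr !(linearP (product _ _ _)).
    by rewrite (linearP (sp_map _ _)) Px Py.
  rewrite !product_structure // QT_map_structure ?compatible_sum //.
  apply: (congr2 (@structure k _)).
  - by apply: quandleP => -[a|a] [b|b]; rewrite !mkquandleE /pull_op mkquandleE.
  - by apply: topologyP => -[a|a] [b|b]; rewrite top_pullE !top_sumE.
move=> x; elim/QT_spans => [|a y z Py Pz|_ [R [S [d ->]]]]; last exact: half.
- by rewrite linear0l linear0r !linear0.
- rewrite tensDl tensZl tensDr tensZr !(linearP (product _ _ _)).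
  by rewrite (linearP (sp_map _ _)) Py Pz.
Qed.

(** Naturality of the product on one summand. Every point has the form [glue_fun z], and on such
    points both inverse gluings compute. *)
Lemma tq_sum_glue (A B : finType) (f : bij A B) (I : {set A})
    (s : top_quandle (subfin (f @: I))) (t : top_quandle (subfin (~: (f @: I)))) :
  tq_pull (sym_bij (glue_bij I))
    (tq_sum (tq_pull (bij_restr f I) s) (tq_pull (bij_restrC f I) t)) =
  tq_pull f (tq_pull (sym_bij (glue_bij (f @: I))) (tq_sum s t)).
Proof.
set J := f @: I.
have gI z : sym_bij (glue_bij I) (glue_fun z) = z by exact: (bij_funK (glue_bij I)).
pose g (z : subfin I + subfin (~: I)) : subfin J + subfin (~: J) :=
  match z with inl x => inl (bij_restr f I x) | inr y => inr (bij_restrC f I y) end.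
have gJ z : sym_bij (glue_bij J) (f (glue_fun z)) = g z.
  have -> : f (glue_fun z) = glue_fun (g z) by case: z.
  exact: (bij_funK (glue_bij J)).
have glueP (a : A) : exists z : subfin I + subfin (~: I), a = glue_fun z.
  by exists (bij_inv (glue_bij I) a); apply/esym; exact: (bij_invK (glue_bij I)).
apply: top_quandleP => a b; have [z ->] := glueP a; have [w ->] := glueP b.
- rewrite !tq_pull_opE !tq_sum_opE !gI !gJ.
  by case: z w => x [y|y]; rewrite /= ?tq_pull_opE ?bij_funK.
- rewrite !tq_pull_leE !tq_sum_leE !gI !gJ.
  by case: z w => x [y|y]; rewrite /= ?tq_pull_leE.
Qed.

Lemma QT_mul_species_morphism : species_morphism m.
Proof.
move=> A B f u.
(* Direct image along [f] matches the subsets of [A] and [B] that index the summands of the two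
   products. *)
have fK : cancel (fun I : {set A} => f @: I) (fun J : {set B} => bij_inv f @: J).
  move=> I; rewrite -imset_comp -[RHS]imset_id.
  by apply: eq_imset => x /=; rewrite bij_funK.
have fKV : cancel (fun J : {set B} => bij_inv f @: J) (fun I : {set A} => f @: I).
  move=> J; rewrite -imset_comp -[RHS]imset_id.
  by apply: eq_imset => x /=; rewrite bij_invK.
apply: etrans (esym (linear_sum (sp_map (QT k) f) _ _ _)).
rewrite [RHS](reindex_onto (fun I : {set A} => f @: I)
  (fun J : {set B} => bij_inv f @: J)) => [|J _]; last exact: fKV.
apply: eq_big => [I|I _]; first by rewrite fK eqxx.
rewrite ffunE; move: (u (f @: I)).
set L := free_bilift _; set R := free_bilift _.
have LR s t : L (tmap (sp_map (QT k) (bij_restr f I)) (sp_map (QT k) (bij_restrC f I))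
    (tq_vect k s ⊗ tq_vect k t)) = sp_map (QT k) f (R (tq_vect k s ⊗ tq_vect k t)).
  rewrite tmapE !QT_map_vect.
  rewrite [LHS]free_biliftE.
  rewrite tq_sum_glue -QT_map_vect.
  by congr (sp_map (QT k) f _); rewrite [RHS]free_biliftE.
apply: (QT_tensor_lin_eq (f := L \o tmap _ _) (g := sp_map (QT k) f \o R)).
move=> Q T O U c d; rewrite (structureE k c) (structureE k d).
exact: LR.
Qed.
End Bialgebra.

Theorem theorem3p3 (k : fieldType) :
  commutative_twisted_bialgebra (@QT_mul k) (@QT_coprod k).
Proof.
split; last exact: QT_product_commutative.
exists (QT_unit k), (QT_counit k); split.
- exact: QT_mul_species_morphism.
- exact: coprod_species_morphism.
- exact: counit_species_morphism.
- exact: QT_product_assoc.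
- exact: QT_product_unitl.
- exact: QT_product_unitr.
- exact: coprod_coassoc.
- exact: coprod_counitl.
- exact: coprod_counitr.
- exact: coprod_product.
- exact: coprod_unit.
- exact: QT_counit_product.
- exact: counit_unit1.
Qed.
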